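(* Let $d\ge2$. On $\mathbb{RP}^{d-1}$, the kernel $B(x,y)=\exp((x\cdot y)^2-1)$ has a unique energy minimizer among Borel probability measures, namely the rotation-invariant probability measure $\sigma$; this measure is nonatomic. For every even integer $q\ge6$, every minimizer (among Borel probability measures on $\mathbb{RP}^{d-1}$) of the energy of $$B_q(x,y)=B(x,y)-\frac2q|x\cdot y|^q$$ has finite support. All such minimizing measures converge weakly to $\sigma$ as $q\to\infty$ (through even integers, for every choice of a minimizer for each $q$), and their support cardinalities tend to infinity.
   Context: $\mathbb{RP}^{d-1}$ is the set of lines in $\mathbb R^d$, each represented by a unit vector $x$ up to sign; even functions of $x\cdot y$ are well defined on it. The energy of a continuous symmetric kernel $K$ at a probability measure $\mu$ is $I_K(\mu)=\iint K(x,y)\,d\mu(x)\,d\mu(y)$. *)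

(* Defs.v *)
From HB Require Import structures.
From mathcomp Require Import all_boot all_order all_algebra.
From mathcomp Require Import finmap.
From mathcomp Require Import all_classical all_reals all_analysis.

Set Implicit Arguments.
Unset Strict Implicit.
Unset Printing Implicit Defensive.

Import Order.TTheory GRing.Theory Num.Theory.
Import numFieldNormedType.Exports.

Local Open Scope classical_set_scope.
Local Open Scope ring_scope.
Local Open Scope quotient_scope.

Definition dotp (R : realType) (m : nat) (u v : 'rV[R]_m) : R :=
  \sum_(i < m) u 0 i * v 0 i.

Lemma dotpNl (R : realType) (m : nat) (u v : 'rV[R]_m) :
  dotp (- u) v = - dotp u v.
Proof. by rewrite /dotp -sumrN; apply: eq_bigr => i _; rewrite mxE mulNr. Qed.

Lemma dotpC (R : realType) (m : nat) (u v : 'rV[R]_m) : dotp u v = dotp v u.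
Proof. by apply: eq_bigr => i _; rewrite mulrC. Qed.

Lemma dotpE (R : realType) (m : nat) (u v : 'rV[R]_m) :
  dotp u v = (u *m v^T) 0 0.
Proof. by rewrite mxE; apply: eq_bigr => i _; rewrite mxE. Qed.

Definition unit_vectors (R : realType) (n : nat) : set 'rV[R]_n.+1 :=
  [set u | dotp u u = 1].

Definition sphere (R : realType) (n : nat) : Type :=
  set_type (@unit_vectors R n).

Section sphere_instances.
Variables (R : realType) (n : nat).

HB.instance Definition _ := SubType.on (sphere R n).
HB.instance Definition _ := Topological.on (sphere R n).

Lemma delta_unit_vector : (delta_mx 0 0 : 'rV[R]_n.+1) \in @unit_vectors R n.
Proof.
rewrite inE /unit_vectors /= /dotp (bigD1 ord0) //= big1 ?addr0.
  by rewrite mxE !eqxx mulr1.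
by move=> i i0; rewrite mxE (negbTE i0) andbF mulr0.
Qed.

HB.instance Definition _ := isPointed.Build (sphere R n)
  (exist (fun u => u \in @unit_vectors R n) _ delta_unit_vector).

End sphere_instances.

Definition antipodal (R : realType) (n : nat) (x y : sphere R n) : bool :=
  (val x == val y) || (val x == - val y).

Section projective_space.
Variables (R : realType) (n : nat).

Lemma antipodal_is_equiv : equiv_class_of (@antipodal R n).
Proof.
split=> [x|x y|y x z]; rewrite /antipodal.
- by rewrite eqxx.
- by rewrite eq_sym -eqr_oppLR [- val x == _]eq_sym [RHS]orbC orbC.
- case/orP=> /eqP ->; first by [].
  by rewrite eqr_opp eqr_oppLR orbC.
Qed.

Canonical antipodal_equiv := EquivRelPack antipodal_is_equiv.

(* RP^n, the space of lines of R^(n+1): the sphere S^n modulo x ~ -x, with the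
   quotient topology and its Borel sigma-algebra *)
Definition RP : Type := quotient_topology {eq_quot antipodal_equiv}.

HB.instance Definition _ := PointedTopological.on RP.
HB.instance Definition _ := Quotient.on RP.
HB.instance Definition _ :=
  Measurable.copy RP (g_sigma_algebraType (@open RP)).

End projective_space.

(* The scalar product of chosen unit representatives of two lines: it is
   well defined only up to sign, so that only even functions of it are
   meaningful (see norm_rpdot_pi). *)
Definition rpdot (R : realType) (n : nat) (x y : RP R n) : R :=
  dotp (val (repr x : sphere R n)) (val (repr y : sphere R n)).

Lemma repr_piP (R : realType) (n : nat) (x : sphere R n) :
  let x' : sphere R n := repr (\pi_(RP R n) x) in
  val x' = val x \/ val x' = - val x.
Proof.
move=> x'; have : x' == x %[mod_eq @antipodal_equiv R n].
  by apply/eqP; exact: reprK.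
by rewrite eqmodE => /orP[] /eqP; [left|right].
Qed.

Lemma norm_rpdot_pi (R : realType) (n : nat) (x y : sphere R n) :
  `|rpdot (\pi_(RP R n) x) (\pi_(RP R n) y)| = `|dotp (val x) (val y)|.
Proof.
have dotpNr (u v : 'rV[R]_n.+1) : dotp u (- v) = - dotp u v.
  by rewrite dotpC dotpNl dotpC.
rewrite /rpdot; case: (repr_piP x) => ->; case: (repr_piP y) => ->;
  by rewrite ?dotpNl ?dotpNr ?normrN.
Qed.

(* the line spanned by a unit vector v (a junk value for other vectors) *)
Definition line_of (R : realType) (n : nat) (v : 'rV[R]_n.+1) : RP R n :=
  \pi_(RP R n) (insubd (point : sphere R n) v).

Definition rotation (R : realType) (m : nat) (Q : 'M[R]_m) : Prop :=
  Q *m Q^T = 1%:M /\ \det Q = 1.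

Definition rotate (R : realType) (n : nat) (Q : 'M[R]_n.+1) (x : RP R n) :
  RP R n := line_of (val (repr x : sphere R n) *m Q).

Lemma rotation_unit_vector (R : realType) (n : nat) (Q : 'M[R]_n.+1)
    (x : sphere R n) :
  rotation Q -> val x *m Q \in @unit_vectors R n.
Proof.
move=> [QQ _]; have := valP x; rewrite !inE /unit_vectors /= => x1.
by rewrite dotpE trmx_mul mulmxA -(mulmxA (val x)) QQ mulmx1 -dotpE.
Qed.

Lemma rotate_pi (R : realType) (n : nat) (Q : 'M[R]_n.+1) (x : sphere R n) :
  rotation Q -> rotate Q (\pi_(RP R n) x) = line_of (val x *m Q).
Proof.
move=> rQ; rewrite /rotate /line_of.
set u := insubd _ _; set v := insubd _ _.
suff : u == v %[mod_eq @antipodal_equiv R n] by move/eqP.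
rewrite eqmodE; apply/orP; rewrite !insubdK ?rotation_unit_vector //.
by case: (repr_piP x) => ->; [left|right; rewrite mulNmx].
Qed.

Section measures_on_projective_space.
Variables (R : realType) (n : nat).
Implicit Types (mu nu : probability (RP R n) R) (K : RP R n -> RP R n -> R).

(* A measure is a function on all sets, but only its values on the Borel sets
   are relevant. *)
Definition same_measure mu nu : Prop :=
  forall A : set (RP R n), measurable A -> mu A = nu A.

Definition unique_probability (P : probability (RP R n) R -> Prop) mu : Prop :=
  P mu /\ forall nu, P nu -> same_measure nu mu.

Definition rotation_invariant mu : Prop :=
  forall Q : 'M[R]_n.+1, rotation Q ->
  forall A : set (RP R n), measurable A -> mu (rotate Q @^-1` A) = mu A.

Definition nonatomic mu : Prop :=
  forall A : set (RP R n), measurable A -> (0 < mu A)%E ->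
  exists B : set (RP R n),
    [/\ measurable B, B `<=` A, (0 < mu B)%E & (mu B < mu A)%E].

Definition energy K mu : \bar R :=
  (\int[mu]_x \int[mu]_y (K x y)%:E)%E.

Definition energy_minimizer K mu : Prop :=
  forall nu, (energy K mu <= energy K nu)%E.

Definition msupport mu : set (RP R n) :=
  [set x | forall U : set (RP R n), open U -> U x -> (0 < mu U)%E].

(* Boundedness of the test functions is automatic as RP^n is compact. *)
Definition weakly_converges (mu_ : nat -> probability (RP R n) R) mu : Prop :=
  forall f : RP R n -> R, continuous f ->
    (\int[mu_ k]_x (f x)%:E)%E @[k --> \oo] --> (\int[mu]_x (f x)%:E)%E.

Definition kernelB (x y : RP R n) : R := expR (rpdot x y ^+ 2 - 1).

Definition kernelBq (q : nat) (x y : RP R n) : R :=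
  kernelB x y - 2 / q%:R * `|rpdot x y| ^+ q.

End measures_on_projective_space.

(* Main.v *)
(* Write s(x, y) = (x . y)^2 and I_k(mu) for the energy of the kernel s^k.  As
   s^k is a finite sum of products phi_J(x) phi_J(y) of monomials in the entries
   of the projections onto the lines, I_k(mu) is a sum of squares of moments.  If
   the potential of s^k under sigma is a constant c_k for every k, then
   I_k(mu) - c_k is the sum of the squares of the differences between the moments
   of mu and sigma, and expanding exp(s - 1) in powers of s bounds the excess
   energy I_B(mu) - I_B(sigma) below by a multiple of it.  The zonal averages of
   s(x, y)^k f(y) against sigma approximate f uniformly, so the moments determine
   mu.  This yields uniqueness, invariance, and weak convergence: a minimizer mu
   for B_q satisfies I_B(mu) - I_B(sigma) <= 2/q.  Since c_k tends to 0 while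
   I_k(mu) is bounded below in terms of the number of support points, that number
   tends to infinity.  The measure sigma is built by induction on the dimension
   from spherical coordinates.

   For the finiteness of the support, the second variation shows that B_q is
   conditionally positive definite on the support of a minimizer, while
   B_q(x, x) - B_q(x, y) vanishes to fourth order at y = x because q >= 6.  On
   three support points this forces B_q(x, .) to vary quadratically near any
   support point p, so near an accumulation point p the secant directions from p
   would be asymptotically orthogonal to each other, which compactness of the
   unit sphere forbids. *)

From HB Require Import structures.
From mathcomp Require Import all_boot all_order all_algebra.
From mathcomp Require Import finmap.
From mathcomp Require Import all_classical all_reals all_analysis.
From mathcomp Require Import measurable_realfun.
From mathcomp Require Import ring lra.
Require Import Defs.

Set Implicit Arguments.
Unset Strict Implicit.
Unset Printing Implicit Defensive.

Import Order.TTheory GRing.Theory Num.Theory.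
Import numFieldNormedType.Exports.

Local Open Scope classical_set_scope.
Local Open Scope ring_scope.

(** * Integration of bounded measurable functions *)

Section bounded_measurable.
Context d (T : measurableType d) (R : realType).
Implicit Types (f g : T -> R) (mu : probability T R).

(** This class is closed under sums and products and is integrable for every probability measure, so
    the linearity of [mean] carries no separate integrability conditions. *)
Definition bounded_measurable f :=
  measurable_fun setT f /\ exists M, forall x, `|f x| <= M.

Definition mean mu f : R := \int[mu]_x f x.

Lemma bm_integrable mu f : bounded_measurable f ->
  mu.-integrable setT (EFin \o f).
Proof.
move=> [mf [M fM]]; apply: measurable_bounded_integrable => //.
  by apply: (le_lt_trans (probability_le1 mu measurableT)); exact: ltry.
exists M; split=> [|N MN x _ /=]; first exact: num_real.
apply: le_trans (fM x) (ltW MN).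
Qed.

Lemma integral_mean mu f : bounded_measurable f ->
  (\int[mu]_x (f x)%:E)%E = (mean mu f)%:E.
Proof.
by move=> bf; rewrite /mean /Rintegral fineK//; exact: integrable_fin_num (bm_integrable mu bf).
Qed.

Lemma bm_cst c : bounded_measurable (fun=> c).
Proof. by split=> //; exists `|c|. Qed.

Lemma bmD f g : bounded_measurable f -> bounded_measurable g ->
  bounded_measurable (fun x => f x + g x).
Proof.
move=> [mf [M fM]] [mg [N gN]]; split; first exact: measurable_funD.
by exists (M + N) => x; rewrite (le_trans (ler_normD _ _))// lerD.
Qed.

Lemma bmM f g : bounded_measurable f -> bounded_measurable g ->
  bounded_measurable (fun x => f x * g x).
Proof.
move=> [mf [M fM]] [mg [N gN]]; split; first exact: measurable_funM.
by exists (M * N) => x; rewrite normrM ler_pM.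
Qed.

Lemma bmZ c f : bounded_measurable f -> bounded_measurable (fun x => c * f x).
Proof. by apply: bmM; exact: bm_cst. Qed.

Lemma bmN f : bounded_measurable f -> bounded_measurable (fun x => - f x).
Proof.
move=> /(bmZ (-1)); congr bounded_measurable.
by apply/funext => x; rewrite mulN1r.
Qed.

Lemma bmB f g : bounded_measurable f -> bounded_measurable g ->
  bounded_measurable (fun x => f x - g x).
Proof. by move=> bf bg; apply: bmD => //; exact: bmN. Qed.

Lemma bm_sum (I : Type) (s : seq I) (P : pred I) (F : I -> T -> R) :
  (forall i, bounded_measurable (F i)) ->
  bounded_measurable (fun x => \sum_(i <- s | P i) F i x).
Proof.
move=> bF; elim: s => [|i s ih].
  by under eq_fun do rewrite big_nil; exact: bm_cst.
under eq_fun do rewrite big_cons; case: (P i) => //.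
exact: bmD.
Qed.

Lemma bmX f k : bounded_measurable f -> bounded_measurable (fun x => f x ^+ k).
Proof.
move=> bf; elim: k => [|k ih]; first by under eq_fun do rewrite expr0; exact: bm_cst.
by under eq_fun do rewrite exprS; exact: bmM.
Qed.

Lemma bm_indic (A : set T) : measurable A -> bounded_measurable (\1_A : T -> R).
Proof.
move=> mA; split; first exact: measurable_indic.
by exists 1 => x; rewrite indicE; case: (x \in A); rewrite /= ?normr1 ?normr0.
Qed.

Lemma mean_cst mu c : mean mu (fun=> c) = c.
Proof. by rewrite /mean Rintegral_cst//= probability_setT mulr1. Qed.

Lemma meanD mu f g : bounded_measurable f -> bounded_measurable g ->
  mean mu (fun x => f x + g x) = mean mu f + mean mu g.
Proof. by move=> bf bg; rewrite /mean RintegralD//; exact: bm_integrable. Qed.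

Lemma meanZ mu c f : bounded_measurable f ->
  mean mu (fun x => c * f x) = c * mean mu f.
Proof. by move=> bf; rewrite /mean RintegralZl//; exact: bm_integrable. Qed.

Lemma meanB mu f g : bounded_measurable f -> bounded_measurable g ->
  mean mu (fun x => f x - g x) = mean mu f - mean mu g.
Proof. by move=> bf bg; rewrite /mean RintegralB//; exact: bm_integrable. Qed.

Lemma mean_sum mu (I : Type) (s : seq I) (P : pred I) (F : I -> T -> R) :
  (forall i, bounded_measurable (F i)) ->
  mean mu (fun x => \sum_(i <- s | P i) F i x) =
  \sum_(i <- s | P i) mean mu (F i).
Proof.
move=> bF; elim: s => [|i s ih].
  by rewrite big_nil -[RHS](mean_cst mu); congr mean; apply/funext => x; rewrite big_nil.
rewrite big_cons -ih; under eq_fun do rewrite big_cons.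
by case: (P i) => //; rewrite meanD//; exact: bm_sum.
Qed.

Lemma mean_le mu f g : bounded_measurable f -> bounded_measurable g ->
  (forall x, f x <= g x) -> mean mu f <= mean mu g.
Proof. by move=> bf bg fg; apply: le_Rintegral => //; exact: bm_integrable. Qed.

Lemma mean_ge0 mu f : (forall x, 0 <= f x) -> 0 <= mean mu f.
Proof. by move=> f0; exact: Rintegral_ge0. Qed.

Lemma mean_dist mu f g e : bounded_measurable f -> bounded_measurable g ->
  (forall x, `|f x - g x| <= e) -> `|mean mu f - mean mu g| <= e.
Proof.
move=> bf bg fge; rewrite ler_distl; apply/andP; split.
  rewrite -[X in _ - X](mean_cst mu) -meanB//; last exact: bm_cst.
  by apply: mean_le => // [|x]; [apply: bmB => //; exact: bm_cst|have := fge x; rewrite ler_distl => /andP[]].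
rewrite -[X in _ + X](mean_cst mu) -meanD//; last exact: bm_cst.
by apply: mean_le => // [|x]; [apply: bmD => //; exact: bm_cst|have := fge x; rewrite ler_distl => /andP[]].
Qed.

Lemma mean_indic mu (A : set T) : measurable A -> (mean mu \1_A)%:E = mu A.
Proof.
move=> mA; rewrite -integral_mean; last exact: bm_indic.
by rewrite integral_indic// setIT.
Qed.

(** The measure integrates [f] over each set; its Radon-Nikodym derivative agrees almost everywhere
    with [f], since both have the same integrals. It yields the angular law of the sphere and the
    perturbations of a minimizer. *)
Lemma mean_density mu f : bounded_measurable f -> (forall x, 0 <= f x) ->
  mean mu f = 1 ->
  exists nu : probability T R, forall g, bounded_measurable g ->
    mean nu g = mean mu (fun x => f x * g x).
Proof.
move=> bf f0 f1; have [mf _] := bf.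
pose nu0 (A : set T) : \bar R := (\int[mu]_(x in A) (f x)%:E)%E.
have nu00 : nu0 set0 = 0%E by rewrite /nu0 integral_set0.
have nu0_ge0 A : (0 <= nu0 A)%E by apply: integral_ge0 => x _; rewrite lee_fin.
have nu0_add : semi_sigma_additive nu0.
  move=> /= F mF tF mUF; rewrite /nu0; apply: cvg_toP.
    apply: ereal_nondecreasing_is_cvgn => m n mn.
    by apply: lee_sum_nneg_natr => // k _ _; exact: nu0_ge0.
  rewrite ge0_integral_bigcup//=; first exact/measurable_EFinP/measurable_funTS.
  by move=> x _; rewrite lee_fin.
have nu0T : nu0 setT = 1%E by rewrite /nu0 integral_mean// f1.
pose nuM := isMeasure.Build _ _ _ nu0 nu00 nu0_ge0 nu0_add.
pose nuMeas : {measure set T -> \bar R} := HB.pack nu0 nuM.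
pose nuP := Measure_isProbability.Build _ _ R nuMeas nu0T.
pose nu : probability T R := HB.pack nu0 nuM nuP.
have numu : nu `<< mu.
  apply/null_content_dominatesP => A mA muA0; rewrite /= /nu0.
  apply: null_set_integral => //; last exact/measurable_EFinP/measurable_funTS.
exists nu => g bg.
rewrite /mean /Rintegral; congr fine.
rewrite -(Radon_Nikodym_change_of_variables numu)//; last exact: bm_integrable.
have mg : measurable_fun setT g by case: bg.
have aeq : ae_eq mu setT (EFin \o f) (Radon_Nikodym (charge_of_finite_measure nu) mu).
  apply: integral_ae_eq => //.
  - exact: bm_integrable.
  - move=> A _ mA; rewrite -Radon_Nikodym_integral//.
apply: ae_eq_integral => //.
- apply: emeasurable_funM; first exact/measurable_EFinP.
  apply: measurable_int; exact: Radon_Nikodym_integrable.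
- by apply/measurable_EFinP; exact: measurable_funM.
apply: filterS aeq => x /= /(_ I) <- _.
by rewrite EFinM muleC.
Qed.

End bounded_measurable.

Lemma mean_distribution d d' (T : measurableType d) (T' : measurableType d')
    (R : realType) (h : {mfun T >-> T'}) (mu : probability T R) f :
  bounded_measurable f ->
  mean (distribution mu h) f = mean mu (f \o h).
Proof.
move=> [mf [M fM]]; rewrite /mean /Rintegral; congr fine.
rewrite integral_distribution//; first exact/measurable_EFinP.
apply: (@bm_integrable _ _ _ mu (f \o h)); split.
  exact: measurableT_comp.
by exists M => x; exact: fM.
Qed.

(** * Means over product spaces *)

Section iterated.
Context d1 d2 (T1 : measurableType d1) (T2 : measurableType d2) (R : realType).
Variables (mu : probability T1 R) (nu : probability T2 R).
Implicit Type H : T1 * T2 -> R.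

Lemma bm_fst (f : T1 -> R) :
  bounded_measurable f -> bounded_measurable (fun z : T1 * T2 => f z.1).
Proof.
move=> [mf [M fM]]; split; last by exists M => z.
exact: measurableT_comp mf measurable_fst.
Qed.

Lemma bm_snd (f : T2 -> R) :
  bounded_measurable f -> bounded_measurable (fun z : T1 * T2 => f z.2).
Proof.
move=> [mf [M fM]]; split; last by exists M => z.
exact: measurableT_comp mf measurable_snd.
Qed.

Lemma bm_pair1 H x : bounded_measurable H -> bounded_measurable (fun y => H (x, y)).
Proof.
move=> [mH [M HM]]; split; last by exists M => y.
exact: measurableT_comp mH (pair1_measurable x).
Qed.

Lemma bm_mean H : bounded_measurable H ->
  bounded_measurable (fun x => mean nu (fun y => H (x, y))).
Proof.
move=> bH; have [mH [M HM]] := bH; split.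
  have -> : (fun x => mean nu (fun y => H (x, y))) =
            fine \o fubini_F nu (EFin \o H) by [].
  apply: measurableT_comp => //.
  apply: (@measurable_fubini_F _ _ _ _ _ mu nu).
  exact: (@bm_integrable _ _ _ (mu \x nu)%E).
exists M => x; rewrite -[X in `|X|]subr0 -[X in _ - X](mean_cst nu).
apply: mean_dist; [exact: bm_pair1|exact: bm_cst|].
by move=> y; rewrite subr0.
Qed.

Lemma mean_prod H : bounded_measurable H ->
  mean (mu \x nu)%E H = mean mu (fun x => mean nu (fun y => H (x, y))).
Proof.
move=> bH; apply: EFin_inj; rewrite -integral_mean// -integral_mean; last exact: bm_mean.
rewrite -integral12_prod_meas1; last exact: (@bm_integrable _ _ _ (mu \x nu)%E).
by apply: eq_integral => x _; rewrite -integral_mean//; exact: bm_pair1.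
Qed.

End iterated.

(** * Geometry and topology of projective space *)

Section continuous_real_functions.
Context (R : realType) (T : topologicalType).

Lemma continuous_sum (J : Type) (r : seq J) (P : pred J) (f : J -> T -> R) :
  (forall j, continuous (f j)) ->
  continuous (fun x => \sum_(j <- r | P j) f j x).
Proof.
move=> cf; elim: r => [|j r ih].
  by under eq_fun do rewrite big_nil; move=> x; exact: cvg_cst.
under eq_fun do rewrite big_cons; case: (P j) => // x.
exact: (continuousD (cf j x) (ih x)).
Qed.

Lemma continuous_prod (J : Type) (r : seq J) (P : pred J) (f : J -> T -> R) :
  (forall j, continuous (f j)) ->
  continuous (fun x => \prod_(j <- r | P j) f j x).
Proof.
move=> cf; elim: r => [|j r ih].
  by under eq_fun do rewrite big_nil; move=> x; exact: cvg_cst.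
under eq_fun do rewrite big_cons; case: (P j) => // x.
exact: (continuousM (cf j x) (ih x)).
Qed.

Lemma continuous_exp (f : T -> R) k :
  continuous f -> continuous (fun x => f x ^+ k).
Proof.
move=> cf; have -> : (fun x => f x ^+ k) = fun x => \prod_(i < k) f x.
  by apply/funext => x; rewrite prodr_const card_ord.
exact: continuous_prod.
Qed.

End continuous_real_functions.

Section scalar_product.
Context (R : realType) (m : nat).
Implicit Types u v w : 'rV[R]_m.

Lemma dotpDl u v w : dotp (u + v) w = dotp u w + dotp v w :> R.
Proof. by rewrite !dotpE mulmxDl mxE. Qed.

Lemma dotpZl (a : R) u w : dotp (a *: u) w = a * dotp u w.
Proof. by rewrite !dotpE -scalemxAl mxE. Qed.

Lemma dotpBl u v w : dotp (u - v) w = dotp u w - dotp v w :> R.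
Proof. by rewrite dotpDl dotpNl. Qed.

Lemma dotp_ge0 u : 0 <= dotp u u.
Proof. by apply: sumr_ge0 => i _; rewrite -expr2 sqr_ge0. Qed.

Lemma dotp_eq0 u : dotp u u = 0 -> u = 0.
Proof.
move=> u0; apply/rowP => i; rewrite mxE; apply/eqP; rewrite -sqrf_eq0 expr2.
by move/eqP: u0; rewrite psumr_eq0 => [/allP/(_ i)|j _]; [rewrite mem_index_enum => /(_ isT)|rewrite -expr2 sqr_ge0].
Qed.

Lemma dotpBB u v : dotp (u - v) (u - v) = dotp u u - 2 * dotp u v + dotp v v.
Proof.
by rewrite dotpBl ![dotp _ (u - v)]dotpC !dotpBl (dotpC v u); ring.
Qed.

Lemma dotpDD u v : dotp (u + v) (u + v) = dotp u u + 2 * dotp u v + dotp v v.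
Proof.
by rewrite dotpDl ![dotp _ (u + v)]dotpC !dotpDl (dotpC v u); ring.
Qed.

Lemma dotp_coord u i : u 0 i ^+ 2 <= dotp u u.
Proof.
rewrite /dotp (bigD1 i)//= -expr2 lerDl.
by apply: sumr_ge0 => j _; rewrite -expr2 sqr_ge0.
Qed.

Lemma dotp_continuous u : continuous (dotp u).
Proof.
apply: continuous_sum => i w.
exact: (continuousM (@cst_continuous _ R (u 0 i) w) (@coord_continuous R 1 m 0 i w)).
Qed.

Lemma dotpp_continuous : continuous (fun u => dotp u u).
Proof.
apply: continuous_sum => i w.
by apply: continuousM; exact: coord_continuous.
Qed.

End scalar_product.

Section projective_geometry.
Local Open Scope quotient_scope.
Context (R : realType) (n : nat).
Implicit Types (x y z : RP R n) (u v : 'rV[R]_n.+1).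
Local Notation X := (RP R n).
Local Notation I := ('I_n.+1 * 'I_n.+1)%type.

Definition rep x : 'rV[R]_n.+1 := val (repr x : sphere R n).

Definition sqdot x y : R := rpdot x y ^+ 2.

(* the entries of the orthogonal projection onto the line [x] *)
Definition proj_entry (p : I) x : R := rep x 0 p.1 * rep x 0 p.2.

Lemma dotp_rep x : dotp (rep x) (rep x) = 1.
Proof. by have := valP (repr x : sphere R n); rewrite inE. Qed.

Lemma line_of_rep x : line_of (rep x) = x.
Proof. by rewrite /line_of /rep valKd reprK. Qed.

Lemma rep_line_of u : dotp u u = 1 ->
  rep (line_of u) = u \/ rep (line_of u) = - u.
Proof.
move=> u1; have := @repr_piP R n (insubd (point : sphere R n) u).
by rewrite insubdK// inE.
Qed.

Lemma proj_entry_line_of u p : dotp u u = 1 ->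
  proj_entry p (line_of u) = u 0 p.1 * u 0 p.2.
Proof.
by move=> /rep_line_of[]; rewrite /proj_entry => ->//; rewrite !mxE mulrNN.
Qed.

Lemma sqdotE x y : sqdot x y = \sum_p proj_entry p x * proj_entry p y.
Proof.
rewrite /sqdot /rpdot -/(rep x) -/(rep y) /dotp expr2 big_distrlr/=.
rewrite pair_big/=; apply: eq_bigr => -[i j] _ /=.
by rewrite /proj_entry/= mulrACA.
Qed.

Lemma sqdotC x y : sqdot x y = sqdot y x.
Proof. by rewrite /sqdot /rpdot dotpC. Qed.

Lemma sqdot_ge0 x y : 0 <= sqdot x y.
Proof. exact: sqr_ge0. Qed.

Lemma sqdotxx x : sqdot x x = 1.
Proof. by rewrite /sqdot /rpdot dotp_rep expr1n. Qed.

Lemma sqdot_le1 x y : sqdot x y <= 1.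
Proof.
have := dotp_ge0 (rep x - rep y); have := dotp_ge0 (rep x + rep y).
rewrite dotpBB dotpDD !dotp_rep /sqdot /rpdot -/(rep x) -/(rep y).
set c := dotp _ _ => h1 h2; rewrite -subr_ge0.
have -> : 1 - c ^+ 2 = (1 - c) * (1 + c) by ring.
by apply: mulr_ge0; lra.
Qed.

(** Equality in Cauchy-Schwarz: the difference or the sum of the two representatives has length
    zero. *)
Lemma sqdot_eq1 x y : sqdot x y = 1 -> x = y.
Proof.
move=> /eqP; rewrite sqrf_eq1 /rpdot -/(rep x) -/(rep y) => /orP[] /eqP xy1.
  rewrite -[x]line_of_rep -[y]line_of_rep; congr line_of.
  apply/subr0_eq/dotp_eq0; rewrite dotpBB !dotp_rep xy1; ring.
have xNy : rep x = - rep y.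
  apply/eqP; rewrite -addr_eq0; apply/eqP/dotp_eq0.
  by rewrite dotpDD !dotp_rep xy1; ring.
rewrite -(reprK x) -(reprK y).
have : (repr x : sphere R n) == repr y %[mod_eq antipodal_equiv R n].
  by rewrite eqmodE /= /antipodal; apply/orP; right; apply/eqP.
by move/eqP.
Qed.

Lemma proj_entry_continuous p : continuous (proj_entry p).
Proof.
apply/quotient_continuous.
have -> : proj_entry p \o \pi_(quotient_topology {eq_quot @antipodal_equiv R n}) =
    fun v : sphere R n => (val v : 'rV[R]_n.+1) 0 p.1 * (val v : 'rV[R]_n.+1) 0 p.2.
  apply/funext => v /=; rewrite /proj_entry /rep.
  by case: (repr_piP v) => ->//; rewrite !mxE mulrNN.
have cv : continuous (val : sphere R n -> 'rV[R]_n.+1) by exact: initial_continuous.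
have cc i : continuous (fun v : sphere R n => (val v : 'rV[R]_n.+1) 0 i).
  move=> v; apply: (@cvg_comp _ _ _ val (fun w : 'rV[R]_n.+1 => w 0 i) _ _ _ (cv v)).
  exact: (@coord_continuous R 1 n.+1 0 i).
by move=> v; exact: (continuousM (cc p.1 v) (cc p.2 v)).
Qed.

Lemma RP_compact : compact [set: X].
Proof.
have -> : [set: X] = (@line_of R n) @` (@unit_vectors R n).
  apply/seteqP; split => x // _; exists (rep x); first exact: dotp_rep.
  exact: line_of_rep.
apply: continuous_compact.
  apply/subspace_sigL_continuousP.
  have -> : sigL (@unit_vectors R n) (@line_of R n) =
      \pi_(quotient_topology {eq_quot @antipodal_equiv R n}).
    by apply/funext => v; rewrite /sigL/= /line_of /= valKd.
  exact: pi_continuous.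
apply: bounded_closed_compact.
  exists 1; split=> [|M M1 u u1]; first exact: num_real.
  rewrite /Num.norm/= mx_normrE; apply: bigmax_le => [|[i j] _ /=].
    by rewrite (le_trans _ (ltW M1)).
  rewrite (le_trans _ (ltW M1))// -(@ler_pXn2r _ 2)// ?nnegrE// expr1n.
  by rewrite real_normK ?num_real// -u1 (ord1 i) dotp_coord.
have -> : @unit_vectors R n = (fun u => dotp u u) @^-1` [set 1] by [].
apply: closed_comp => [u _|]; last exact: closed_eq.
exact: dotpp_continuous.
Qed.

End projective_geometry.

Lemma bm_continuous_comp d (T : measurableType d) (R : realType) (F : R -> R)
    (g : T -> R) :
  continuous F -> bounded_measurable g -> bounded_measurable (F \o g).
Proof.
move=> cF [mg [M gM]]; split.
  by apply: measurableT_comp => //; exact: continuous_measurable_fun.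
have [N [_ FN]] : bounded_set (F @` `[- M, M]).
  apply/compact_bounded/continuous_compact; last exact: segment_compact.
  exact: continuous_subspaceT.
exists (N + 1) => x; apply: (FN (N + 1)); first by rewrite ltrDl.
by exists (g x) => //=; rewrite in_itv/= -ler_norml.
Qed.

(** [D] stands in for a distance. Its minimum over the compact set of pairs at which the values of
    [f] differ by at least [e] is attained off the diagonal, hence positive, and serves as
    [delta]. *)
Lemma compact_modulus (R : realType) (T : topologicalType) (f : T -> R)
    (D : T * T -> R) (e : R) : compact [set: T] -> continuous f -> continuous D ->
  (forall x y, x <> y -> 0 < D (x, y)) -> 0 < e ->
  exists2 delta : R, 0 < delta & forall x y, D (x, y) < delta -> `|f x - f y| < e.
Proof.
move=> cT cf cD D0 e0; pose A := [set z : T * T | e <= `|f z.1 - f z.2|].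
have cA : compact A.
  have cTT : compact [set: T * T] by rewrite -setXTT; exact: compact_setX.
  apply: (subclosed_compact _ cTT) => //.
  have -> : A = (fun z : T * T => `|f z.1 - f z.2|) @^-1` [set r | e <= r] by [].
  apply: closed_comp; last exact: closed_ge.
  move=> z _; apply: cvg_norm; apply: cvgB.
    by apply: (@cvg_comp _ _ _ fst f _ _ _ cvg_fst); exact: cf.
  by apply: (@cvg_comp _ _ _ snd f _ _ _ cvg_snd); exact: cf.
have [A0|A0] := pselect (A !=set0); last first.
  exists 1 => // x y _; rewrite ltNge; apply/negP => efxy.
  by apply: A0; exists (x, y).
have [] := @compact_EVT_min _ R D A A0 cA (continuous_subspaceT cD).
move=> [x0 y0]; rewrite inE => Axy0 Amin.
exists (D (x0, y0)).
  apply: D0 => xy0.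
  by move: Axy0; rewrite /A/= xy0 subrr normr0 leNgt e0.
move=> x y xy; rewrite ltNge; apply/negP => efxy.
have := Amin (x, y); rewrite inE => /(_ efxy).
by rewrite leNgt xy.
Qed.

Section projective_topology.
Context (R : realType) (n : nat).
Local Notation X := (RP R n).
Implicit Types (x y z : X) (U : set X) (f : X -> R).

Lemma RP_open_measurable U : open U -> measurable U.
Proof. exact: sub_sigma_algebra. Qed.

Lemma bm_continuous f : continuous f -> bounded_measurable f.
Proof.
move=> cf; split.
  move=> mT; apply: (measurability _ (RGenOInfty.measurableE R)) => //.
  move=> _ [_ [a ->] <-]; rewrite setTI; apply: RP_open_measurable.
  by apply: (open_comp _ _) => [? _|]; [exact: cf|exact: interval_open].
have [N [_ FN]] : bounded_set (f @` [set: X]).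
  apply/compact_bounded/continuous_compact; last exact: RP_compact.
  exact: continuous_subspaceT.
exists (N + 1) => x; apply: (FN (N + 1)); first by rewrite ltrDl.
by exists x.
Qed.

Lemma bm_proj_entry p : bounded_measurable (@proj_entry R n p).
Proof. by apply: bm_continuous; exact: proj_entry_continuous. Qed.

Lemma bm_sqdot : bounded_measurable (fun z : X * X => sqdot z.1 z.2).
Proof.
under eq_fun do rewrite sqdotE; apply: bm_sum => p; apply: bmM.
  exact: (bm_fst _ (bm_proj_entry p)).
exact: (bm_snd _ (bm_proj_entry p)).
Qed.

Lemma sqdot_continuous : continuous (fun z : X * X => sqdot z.1 z.2).
Proof.
under eq_fun do rewrite sqdotE; apply: continuous_sum => p z.
have c1 : {for z, continuous (fun z : X * X => proj_entry p z.1)}.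
  by apply: (@cvg_comp _ _ _ fst (proj_entry p) _ _ _ cvg_fst); exact: proj_entry_continuous.
have c2 : {for z, continuous (fun z : X * X => proj_entry p z.2)}.
  by apply: (@cvg_comp _ _ _ snd (proj_entry p) _ _ _ cvg_snd); exact: proj_entry_continuous.
exact: (continuousM c1 c2).
Qed.

Lemma sqdotr_continuous x : continuous (sqdot x).
Proof.
have -> : sqdot x = fun y => \sum_p proj_entry p x * proj_entry p y.
  by apply/funext => y; exact: sqdotE.
apply: continuous_sum => p y.
exact: (continuousM (cvg_cst _) (@proj_entry_continuous _ _ p y)).
Qed.

Lemma sqdot_lt1 x y : x <> y -> sqdot x y < 1.
Proof.
move=> xy; rewrite lt_neqAle sqdot_le1 andbT; apply/eqP => /sqdot_eq1.
exact: xy.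
Qed.

Lemma continuous_cap f (e : R) : continuous f -> 0 < e ->
  exists2 delta : R, 0 < delta &
    forall x y, 1 - sqdot x y < delta -> `|f x - f y| < e.
Proof.
move=> cf e0; apply: (@compact_modulus R X f (fun z : X * X => 1 - sqdot z.1 z.2)) => //.
- exact: RP_compact.
- by move=> z; exact: (continuousB (@cst_continuous _ R 1 z) (@sqdot_continuous z)).
- by move=> x y xy; rewrite subr_gt0 sqdot_lt1.
Qed.

(** The quantity [1 - sqdot x y] is the squared sine of the angle, or half the squared distance of
    the projections ([sqdotB]); thus [r] is on a squared scale. *)
Definition cap x (r : R) : set X := [set y | 1 - sqdot x y < r].

Lemma cap_open x r : open (cap x r).
Proof.
have -> : cap x r = sqdot x @^-1` [set t | 1 - r < t].
  by apply/funext => y; rewrite /cap/=; apply/propext; split; lra.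
by apply: open_comp; [move=> y _; exact: sqdotr_continuous|exact: open_gt].
Qed.

Lemma cap_measurable x r : measurable (cap x r).
Proof. by apply: RP_open_measurable; exact: cap_open. Qed.

Lemma cap_center x r : 0 < r -> cap x r x.
Proof. by rewrite /cap/= sqdotxx subrr. Qed.

(** On the compact complement of [U], [sqdot x] attains its maximum, which is below 1 because [x] is
    not there. *)
Lemma open_cap U x : open U -> U x -> exists2 r : R, 0 < r & cap x r `<=` U.
Proof.
move=> oU Ux.
have cU : compact (~` U).
  by apply: (subclosed_compact _ (@RP_compact R n)) => //; exact: open_closedC.
have [U0|U0] := pselect ((~` U) !=set0); last first.
  exists 1 => // y _; apply: contrapT => Uy.
  by apply: U0; exists y.
have [] := @compact_EVT_max _ R (sqdot x) _ U0 cU.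
  by apply: continuous_subspaceT; exact: sqdotr_continuous.
move=> y0; rewrite inE => Uy0 Umax; exists (1 - sqdot x y0).
  by rewrite subr_gt0; apply: sqdot_lt1 => xy0; apply: Uy0; rewrite -xy0.
move=> y; rewrite /cap/= ltrD2l ltrN2 => xy; apply: contrapT => Uy.
have := Umax y; rewrite inE => /(_ Uy).
by rewrite leNgt xy.
Qed.

Lemma cap_cover r : 0 < r -> exists s : seq X, forall y, exists2 x, x \in s & cap x r y.
Proof.
move=> r0; have := @RP_compact R n; rewrite compact_cover.
move=> /(_ _ setT (fun x => cap x r)) [| y _ |D _ Dcover].
- by move=> x _; exact: cap_open.
- by exists y => //; exact: cap_center.
exists (enum_fset D) => y; have [x xD xy] := Dcover y I.
by exists x.
Qed.

Lemma sqdotB x y : 2 * (1 - sqdot x y) =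
  \sum_p (proj_entry p x - proj_entry p y) ^+ 2.
Proof.
under eq_bigr do rewrite sqrrB.
rewrite big_split/= sumrB/=.
have sq1 z : \sum_p proj_entry p z ^+ 2 = 1.
  by rewrite -[RHS](sqdotxx z) sqdotE; apply: eq_bigr => p _; rewrite expr2.
rewrite !sq1 sumrMnl -sqdotE; ring.
Qed.

(** The parallelogram identity for the projections; a squared distance satisfies the triangle
    inequality only up to a factor 2. *)
Lemma sqdot_triangle x y z :
  1 - sqdot y z <= 2 * (1 - sqdot x y) + 2 * (1 - sqdot x z).
Proof.
suff : \sum_p (proj_entry p y - proj_entry p z) ^+ 2 <=
    2 * \sum_p (proj_entry p x - proj_entry p y) ^+ 2 +
    2 * \sum_p (proj_entry p x - proj_entry p z) ^+ 2.
  by rewrite -!sqdotB; lra.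
rewrite !mulr_sumr -big_split/=; apply: ler_sum => p _.
set a := proj_entry p x; set b := proj_entry p y; set c := proj_entry p z.
have -> : 2 * (a - b) ^+ 2 + 2 * (a - c) ^+ 2 = (b - c) ^+ 2 + (b + c - 2 * a) ^+ 2 by ring.
by rewrite lerDl sqr_ge0.
Qed.

(** Second countability: for each [m] take a finite net of caps of radius 1/(m+1), and keep those
    inside [U]. *)
Lemma open_bigcup_cap U : open U -> exists (c : nat -> X) (r : nat -> R),
  U = \bigcup_k cap (c k) (r k).
Proof.
move=> oU.
have /choice[s sP] : forall m : nat, exists s : seq X, forall y, exists2 x, x \in s & cap x m.+1%:R^-1 y.
  by move=> m; apply: cap_cover; rewrite invr_gt0.
pose c (mi : nat * nat) : X := nth point (s mi.1) mi.2.
(* Caps of the nets that leave [U] get radius 0, which makes them empty. *)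
pose r (mi : nat * nat) : R :=
  if `[< cap (c mi) mi.1.+1%:R^-1 `<=` U >] then mi.1.+1%:R^-1 else 0.
pose dec (k : nat) : nat * nat := odflt (0, 0)%N (@choice.unpickle (nat * nat)%type k).
exists (c \o dec), (r \o dec); apply/seteqP; split => [y Uy|y [k _]]; last first.
  rewrite /= /r; case: ifPn => [/asboolP + ky|_]; first exact.
  by rewrite /cap/= ltNge subr_ge0 sqdot_le1.
have [e e0 yU] := open_cap oU Uy.
pose m := Num.trunc (4 / e).
(* [sqdot_triangle] doubles each of two radii 1/(m+1), whence the factor 4. *)
have me : 4 * m.+1%:R^-1 < e.
  rewrite ltr_pdivrMr// mulrC -ltr_pdivrMr//.
  exact: truncnS_gt.
have [x xs xy] := sP m y.
exists (choice.pickle (m, index x (s m))) => //; rewrite /= /dec choice.pickleK/= /r /c/= nth_index//.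
case: asboolP => // -[] z xz; apply: yU; rewrite /cap/=.
apply: le_lt_trans (sqdot_triangle x y z) _.
move: xy xz; rewrite /cap/= => xy xz.
by move: me xy xz; set t := _^-1; lra.
Qed.

(** A cap is a half-space in terms of the projection entries, and every open set is a countable
    union of caps. *)
Lemma measurable_fun_RP d (T : measurableType d) (h : T -> X) :
  (forall p, measurable_fun setT (proj_entry p \o h)) -> measurable_fun setT h.
Proof.
move=> mh; apply: (@measurability _ _ _ _ _ _ (@open X)) => //.
move=> _ [U oU <-]; rewrite setTI.
have [c [r ->]] := open_bigcup_cap oU.
rewrite preimage_bigcup; apply: bigcup_measurable => k _.
have -> : h @^-1` cap (c k) (r k) =
    setT `&` (fun t => \sum_p proj_entry p (c k) * proj_entry p (h t)) @^-1` `]1 - r k, +oo[.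
  rewrite setTI; apply/funext => t; rewrite /cap/= in_itv/= andbT sqdotE.
  by apply/propext; split; lra.
have mF : measurable_fun setT
    (fun t => \sum_p proj_entry p (c k) * proj_entry p (h t)).
  apply: measurable_sum => p; apply: measurable_funM => //.
  exact: mh.
exact: mF.
Qed.

End projective_topology.

(** * Moments and energies *)

Section exponential_partial_sums.
Context (R : realType).

(** The tails are compared term by term. The bound is uniform in [s], so it can be integrated in
    [double_mean_expsq]. *)
Lemma expR_partial_sum (m : nat) (s : R) : 0 <= s <= 1 ->
  0 <= expR s - series (exp_coeff s) m <=
  expR 1 - series (exp_coeff (1 : R)) m.
Proof.
move=> /andP[s0 s1].
have cs (t : R) : series (exp_coeff t) k - series (exp_coeff t) m @[k --> \oo] -->
    expR t - series (exp_coeff t) m.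
  by apply: cvgB; [exact: is_cvg_series_exp_coeff|exact: cvg_cst].
have d0 (t : R) k : (m <= k)%N -> series (exp_coeff t) k - series (exp_coeff t) m =
    \sum_(m <= i < k) exp_coeff t i.
  by move=> mk; rewrite /series/= sub_series_geq.
apply/andP; split.
  rewrite -(cvg_lim _ (cs s))//; apply: limr_ge; first by apply/cvg_ex; eexists; exact: cs.
  near=> k; rewrite d0; last by near: k; exact: nbhs_infty_ge.
  by apply: sumr_ge0 => i _; rewrite /exp_coeff/= divr_ge0// exprn_ge0.
rewrite -(cvg_lim _ (cs s))// -(cvg_lim _ (cs 1))//; apply: ler_lim.
- by apply/cvg_ex; eexists; exact: cs.
- by apply/cvg_ex; eexists; exact: cs.
near=> k; rewrite !d0; [|by near: k; exact: nbhs_infty_ge..].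
apply: ler_sum => i _; rewrite /exp_coeff/= ler_pM2r ?invr_gt0 ?ltr0n ?fact_gt0//.
by rewrite expr1n exprn_ile1.
Unshelve. all: by end_near. Qed.

End exponential_partial_sums.

Section moments.
Context (R : realType) (n : nat).
Local Notation X := (RP R n).
Implicit Types (x y : X) (mu nu sigma : probability X R).

Definition monomial k (J : {ffun 'I_k -> 'I_n.+1 * 'I_n.+1}) x : R :=
  \prod_j proj_entry (J j) x.

Lemma sqdotX k x y : sqdot x y ^+ k =
  \sum_(J : {ffun 'I_k -> 'I_n.+1 * 'I_n.+1}) monomial J x * monomial J y.
Proof.
have -> : sqdot x y ^+ k = \prod_(j < k) \sum_p proj_entry p x * proj_entry p y.
  by rewrite prodr_const card_ord -sqdotE.
by rewrite bigA_distr_bigA; apply: eq_bigr => J _; rewrite /monomial big_split.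
Qed.

Lemma monomial_continuous k (J : {ffun 'I_k -> 'I_n.+1 * 'I_n.+1}) :
  continuous (monomial J).
Proof. by apply: continuous_prod => j; exact: proj_entry_continuous. Qed.

Lemma bm_monomial k (J : {ffun 'I_k -> 'I_n.+1 * 'I_n.+1}) :
  bounded_measurable (monomial J).
Proof. by apply: bm_continuous; exact: monomial_continuous. Qed.

Definition double_mean mu nu (H : X * X -> R) : R :=
  mean mu (fun x => mean nu (fun y => H (x, y))).

Lemma energyE (K : X -> X -> R) mu :
  bounded_measurable (fun z : X * X => K z.1 z.2) ->
  energy K mu = (double_mean mu mu (fun z => K z.1 z.2))%:E.
Proof.
move=> bK; rewrite /energy /double_mean -integral_mean; last first.
  exact: (bm_mean mu mu bK).
by apply: eq_integral => x _; rewrite integral_mean//; exact: (bm_pair1 x bK).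
Qed.

Definition moment mu k (J : {ffun 'I_k -> 'I_n.+1 * 'I_n.+1}) : R :=
  mean mu (monomial J).

Lemma mean_sqdotX mu k x : mean mu (fun y => sqdot x y ^+ k) =
  \sum_(J : {ffun 'I_k -> 'I_n.+1 * 'I_n.+1}) monomial J x * moment mu J.
Proof.
under [X in mean _ X]eq_fun do rewrite sqdotX.
rewrite mean_sum => [|J]; last exact/bmZ/bm_monomial.
by apply: eq_bigr => J _; rewrite meanZ//; exact: bm_monomial.
Qed.

Lemma double_mean_sqdotX mu nu k :
  double_mean mu nu (fun z => sqdot z.1 z.2 ^+ k) =
  \sum_(J : {ffun 'I_k -> 'I_n.+1 * 'I_n.+1}) moment mu J * moment nu J.
Proof.
rewrite /double_mean/=; under [X in mean _ X]eq_fun do rewrite mean_sqdotX.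
under [X in mean _ X]eq_fun do under eq_bigr do rewrite mulrC.
rewrite mean_sum => [|J]; last exact/bmZ/bm_monomial.
by apply: eq_bigr => J _; rewrite meanZ 1?mulrC//; exact: bm_monomial.
Qed.

Lemma bm_sqdotX k : bounded_measurable (fun z : X * X => sqdot z.1 z.2 ^+ k).
Proof. exact/bmX/bm_sqdot. Qed.

Lemma bm_kernel (F : R -> R) : continuous F ->
  bounded_measurable (fun z : X * X => F (sqdot z.1 z.2)).
Proof. by move=> cF; exact: (bm_continuous_comp cF (@bm_sqdot R n)). Qed.

Lemma double_meanD mu nu H G : bounded_measurable H -> bounded_measurable G ->
  double_mean mu nu (fun z => H z + G z) = double_mean mu nu H + double_mean mu nu G.
Proof.
move=> bH bG; rewrite /double_mean -meanD; [|exact: (bm_mean mu nu)..].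
congr mean; apply/funext => x; rewrite meanD//; exact: bm_pair1.
Qed.

Lemma double_meanB mu nu (H G : X * X -> R) : bounded_measurable H ->
  bounded_measurable G ->
  double_mean mu nu (fun z => H z - G z) = double_mean mu nu H - double_mean mu nu G.
Proof.
move=> bH bG; rewrite /double_mean -meanB; [|exact: (bm_mean mu nu)..].
congr mean; apply/funext => x; rewrite meanB//; exact: bm_pair1.
Qed.

Lemma double_meanZ mu nu a (H : X * X -> R) : bounded_measurable H ->
  double_mean mu nu (fun z => a * H z) = a * double_mean mu nu H.
Proof.
move=> bH; rewrite /double_mean -meanZ; last exact: (bm_mean mu nu).
congr mean; apply/funext => x; rewrite meanZ//; exact: bm_pair1.
Qed.

Lemma double_mean_sum mu nu (T : Type) (s : seq T) (P : pred T) (H : T -> X * X -> R) :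
  (forall i, bounded_measurable (H i)) ->
  double_mean mu nu (fun z => \sum_(i <- s | P i) H i z) =
  \sum_(i <- s | P i) double_mean mu nu (H i).
Proof.
move=> bH; rewrite /double_mean -mean_sum => [|i]; last exact: (bm_mean mu nu).
by congr mean; apply/funext => x; rewrite mean_sum// => i; exact: bm_pair1.
Qed.

Lemma double_mean_le mu nu (H G : X * X -> R) : bounded_measurable H ->
  bounded_measurable G -> (forall z, H z <= G z) ->
  double_mean mu nu H <= double_mean mu nu G.
Proof.
move=> bH bG HG; apply: mean_le => [| |x]; [exact: (bm_mean mu nu)..|].
by apply: mean_le => //; exact: bm_pair1.
Qed.

Definition expsq (z : X * X) : R := expR (sqdot z.1 z.2 - 1).

Lemma bm_expsq : bounded_measurable expsq.
Proof.
apply: (bm_kernel (F := fun s => expR (s - 1))) => s.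
have cB : x - 1 @[x --> s] --> s - 1 by apply: cvgB; [exact: cvg_id|exact: cvg_cst].
exact: (cvg_comp _ _ cB (@continuous_expR R (s - 1))).
Qed.

(** * Comparison with a measure of constant potentials *)

Section isotropic.
Variables (sigma : probability X R) (c : nat -> R).
Hypothesis sigmac : forall k x, mean sigma (fun y => sqdot x y ^+ k) = c k.

Lemma double_mean_isotropicr mu k :
  double_mean mu sigma (fun z => sqdot z.1 z.2 ^+ k) = c k.
Proof.
rewrite /double_mean/=; under [X in mean _ X]eq_fun do rewrite sigmac.
exact: mean_cst.
Qed.

(** Since the potential of [sigma] is constant, the mixed energy of [mu] and [sigma] equals [c k],
    as does the energy of [sigma]; expanding the squares leaves a single [- c k]. *)
Lemma moment_discrepancy mu k :
  \sum_(J : {ffun 'I_k -> 'I_n.+1 * 'I_n.+1}) (moment mu J - moment sigma J) ^+ 2 =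
  double_mean mu mu (fun z => sqdot z.1 z.2 ^+ k) - c k.
Proof.
have := double_mean_isotropicr mu k; have := double_mean_isotropicr sigma k.
rewrite !double_mean_sqdotX => ssig smu.
have -> : c k = c k + c k - c k by ring.
rewrite -{1 2}smu -ssig -big_split/= -!sumrB; apply: eq_bigr => J _; ring.
Qed.

Lemma moment_discrepancy_ge0 mu k :
  c k <= double_mean mu mu (fun z => sqdot z.1 z.2 ^+ k).
Proof.
by rewrite -subr_ge0 -moment_discrepancy; apply: sumr_ge0 => J _; exact: sqr_ge0.
Qed.

(** Each term of the power series of exp(s - 1) in s has at least as much energy under [mu] as under
    [sigma]; all terms except the k-th are discarded. *)
Lemma double_mean_expsq mu k :
  (expR (-1) / k`!%:R) * (double_mean mu mu (fun z => sqdot z.1 z.2 ^+ k) - c k) <=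
  double_mean mu mu expsq - double_mean sigma sigma expsq.
Proof.
pose a i : R := expR (-1) / i`!%:R.
have a0 i : 0 <= a i by rewrite divr_ge0// expR_ge0.
(* The remainder after [m] terms is largest at s = 1. *)
pose rho m : R := expR (-1) * (expR 1 - series (exp_coeff (1 : R)) m).
pose P m (z : X * X) := \sum_(0 <= i < m) a i * sqdot z.1 z.2 ^+ i.
have bT i : bounded_measurable (fun z : X * X => a i * sqdot z.1 z.2 ^+ i).
  by apply: bmZ; exact: bm_sqdotX.
have bP m : bounded_measurable (P m) by exact: bm_sum.
have PE m z : P m z = expR (-1) * series (exp_coeff (sqdot z.1 z.2)) m.
  rewrite /P /series/= mulr_sumr; apply: eq_bigr => i _.
  by rewrite /a /exp_coeff/=; ring.
have expsqE z : expsq z = expR (-1) * expR (sqdot z.1 z.2).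
  by rewrite /expsq -expRD addrC.
have s01 (z : X * X) : 0 <= sqdot z.1 z.2 <= 1 by rewrite sqdot_ge0 sqdot_le1.
have Ple m z : P m z <= expsq z.
  rewrite PE expsqE ler_wpM2l ?expR_ge0// -subr_ge0.
  by have /andP[] := expR_partial_sum m (s01 z).
have leP m z : expsq z <= P m z + rho m.
  rewrite PE expsqE /rho -mulrDr ler_wpM2l ?expR_ge0// -lerBlDl.
  by have /andP[] := expR_partial_sum m (s01 z).
have EP m nu : double_mean nu nu (P m) =
    \sum_(0 <= i < m) a i * double_mean nu nu (fun z => sqdot z.1 z.2 ^+ i).
  rewrite double_mean_sum//; apply: eq_bigr => i _.
  by rewrite double_meanZ//; exact: bm_sqdotX.
have main m : (k < m)%N ->
    a k * (double_mean mu mu (fun z => sqdot z.1 z.2 ^+ k) - c k) - rho m <=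
    double_mean mu mu expsq - double_mean sigma sigma expsq.
  move=> km; rewrite lerBlDr.
  have h1 : double_mean mu mu (P m) <= double_mean mu mu expsq.
    by apply: double_mean_le => //; exact: bm_expsq.
  have h2 : double_mean sigma sigma expsq <= double_mean sigma sigma (P m) + rho m.
    rewrite -lerBlDl -(mean_cst sigma (rho m)) -[X in _ <= X](mean_cst sigma).
    rewrite -[X in _ <= X]/(double_mean sigma sigma (fun=> rho m)) -double_meanB//; last exact: bm_expsq.
    apply: double_mean_le => [| |z]; [by apply: bmB => //; exact: bm_expsq|exact: bm_cst|].
    by rewrite lerBlDl.
  have h3 : a k * (double_mean mu mu (fun z => sqdot z.1 z.2 ^+ k) - c k) <=
      double_mean mu mu (P m) - double_mean sigma sigma (P m).
    rewrite !EP -sumrB (bigD1_seq k)/= ?iota_uniq ?mem_index_iota//.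
    rewrite double_mean_isotropicr -mulrBr lerDl; apply: sumr_ge0 => i _.
    by rewrite double_mean_isotropicr -mulrBr mulr_ge0// subr_ge0 moment_discrepancy_ge0.
  by lra.
have rho0 : rho m @[m --> \oo] --> 0.
  rewrite -(mulr0 (expR (-1))) -(subrr (expR 1)).
  apply: cvgM; first exact: cvg_cst.
  by apply: cvgB; [exact: cvg_cst|exact: is_cvg_series_exp_coeff].
rewrite -[X in X <= _]subr0; apply: cvgr_to_le (cvgB (cvg_cst _) rho0) _.
by near=> m; apply: main; near: m; exact: nbhs_infty_gt.
Unshelve. all: by end_near. Qed.

End isotropic.
End moments.

(** * Isotropic measures *)

Section isotropic_consequences.
Context (R : realType) (n : nat).
Local Notation X := (RP R n).
Implicit Types (x y : X) (mu nu : probability X R).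

Lemma continuous_ramp (f : X -> R) (a : R) : continuous f ->
  continuous (fun x => Num.max 0 (f x - a)).
Proof.
move=> cf x; have ca := continuousB (cf x) (@cst_continuous X R a x).
exact: (continuous_max (@cst_continuous X R 0 x) ca).
Qed.

(** Open sets form a pi-system generating the Borel sets, so it suffices to reach the indicator of
    an open set as a bounded pointwise limit of continuous functions. *)
Lemma same_measure_continuous mu nu :
  (forall f : X -> R, continuous f -> mean mu f = mean nu f) ->
  same_measure mu nu.
Proof.
move=> fE A mA.
apply: (@g_sigma_algebra_measure_unique _ R X (@open X) _ (fun=> setT)) => //.
- by move=> U oU; exact: RP_open_measurable.
- by move=> _; exact: openT.
- by apply/seteqP; split => // x _; exists 0%N.
- by move=> U V oU oV; exact: openI.
- move=> U oU; have [ctr [r Uctr]] := open_bigcup_cap oU.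
  (* Each ramp is positive exactly on its cap, so [f N] is eventually 1 at every point of [U] and
     always 0 outside. *)
  pose g N y : R := \sum_(k < N) Num.max 0 (sqdot (ctr k) y - (1 - r k)).
  pose f N y : R := Num.min 1 (N%:R * g N y).
  have g0 N y : 0 <= g N y by apply: sumr_ge0 => k _; rewrite le_max lexx.
  have cf N : continuous (f N).
    have cg : continuous (g N).
      apply: continuous_sum => k; apply: continuous_ramp.
      exact: sqdotr_continuous.
    move=> y; have cNg := continuousM (@cst_continuous X R N%:R y) (cg y).
    exact: (continuous_min (@cst_continuous X R 1 y) cNg).
  have f01 N y : 0 <= f N y <= 1.
    by rewrite ge_min lexx andbT le_min ler01 mulr_ge0.
  have fU y : f N y @[N --> \oo] --> (\1_U y : R).
    rewrite indicE; case: (boolP (y \in U)) => yU.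
      move: yU; rewrite inE Uctr => -[k _ yk].
      have gk : 0 < Num.max 0 (sqdot (ctr k) y - (1 - r k)).
        by rewrite lt_max; apply/orP; right; move: yk; rewrite /cap/=; lra.
      set t := Num.max _ _ in gk.
      apply: cvg_near_cst; near=> N.
      apply/min_idPl.
      have kN : (k < N)%N by near: N; exact: nbhs_infty_gt.
      apply: (@le_trans _ _ (N%:R * t)).
        rewrite -ler_pdivrMr// div1r; near: N; exact: nbhs_infty_ger.
      rewrite ler_wpM2l// /g (bigD1 (Ordinal kN))//= -/t lerDl.
      by apply: sumr_ge0 => i _; rewrite le_max lexx.
    apply: cvg_near_cst; near=> N; rewrite /f /g big1 ?mulr0.
      by apply/min_idPr.
    move=> k _; apply/max_idPl; rewrite leNgt; apply/negP => yk.
    move/negP: yU; apply; rewrite inE Uctr; exists k => //.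
    by move: yk; rewrite /cap/=; lra.
  have mU (m : probability X R) : (\int[m]_y (f N y)%:E)%E @[N --> \oo] --> m U.
    have -> : m U = (\int[m]_y (\1_U y)%:E)%E.
      by rewrite integral_indic ?setIT//; exact: RP_open_measurable.
    apply: (@dominated_cvg _ _ _ m setT measurableT _ _ (cst 1%E)) => //.
    + move=> N; apply/measurable_EFinP.
      by have [] := bm_continuous (cf N).
    + by move=> y _; apply: cvg_EFin; [exact: nearW|exact: fU].
    + exact: (bm_integrable m (bm_cst _ 1)).
    + move=> N y _; have /andP[f0 f1] := f01 N y.
      by rewrite /= ger0_norm// lee_fin.
  apply: (cvg_unique _ (mU mu)) => //.
  have -> : (fun N => (\int[mu]_y (f N y)%:E)%E) = fun N => (\int[nu]_y (f N y)%:E)%E.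
    apply/funext => N; rewrite !integral_mean; [|exact: bm_continuous..].
    by rewrite fE.
  exact: mU.
- by move=> _; rewrite (le_lt_trans (probability_le1 _ _))// ltry.
Unshelve. all: by end_near. Qed.

Section density.
Variables (sigma : probability X R) (c : nat -> R).
Hypothesis sigmac : forall k x, mean sigma (fun y => sqdot x y ^+ k) = c k.

Lemma bm_sqdotrX x k : bounded_measurable (fun y => sqdot x y ^+ k).
Proof. by apply: bmX; apply: bm_continuous; exact: sqdotr_continuous. Qed.

Lemma bm_cap x r : bounded_measurable (\1_(cap x r) : X -> R).
Proof. by apply: bm_indic; exact: cap_measurable. Qed.

(** Some cap of a finite cover by caps of radius [r] has positive mass [m], whatever [k] is, and
    [sqdot x] exceeds [1 - r] on it. *)
Lemma isotropic_moment_lb (r : R) : 0 < r <= 1 ->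
  exists2 m : R, 0 < m & forall k, (1 - r) ^+ k * m <= c k.
Proof.
move=> /andP[r0 r1]; have [s scover] := @cap_cover R n r r0.
have [x m0] : exists x, 0 < mean sigma \1_(cap x r).
  apply: contrapT => /forallNP h.
  have : \sum_(x <- s) mean sigma \1_(cap x r) <= 0.
    by apply: sumr_le0 => x _; rewrite leNgt; apply/negP/h.
  rewrite -mean_sum => [|x]; last exact: bm_cap.
  rewrite leNgt => /negP; apply; apply: lt_le_trans (@ltr01 R) _.
  rewrite -[X in X <= _](mean_cst sigma); apply: mean_le => [| |y].
  - exact: bm_cst.
  - by apply: bm_sum => x; exact: bm_cap.
  have [x xs xy] := scover y.
  rewrite (big_rem x)//= indicE mem_set//= lerDl.
  by apply: sumr_ge0 => z _; rewrite indicE.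
exists (mean sigma \1_(cap x r)) => // k.
rewrite -(sigmac k x) -meanZ; last exact: bm_cap.
apply: mean_le => [| |y].
- by apply: bmZ; exact: bm_cap.
- exact: bm_sqdotrX.
rewrite indicE; case: (boolP (y \in _)) => [|_]; last first.
  by rewrite mulr0 exprn_ge0// sqdot_ge0.
rewrite inE /cap/= mulr1 => xy; apply: lerXn2r; rewrite ?nnegrE ?sqdot_ge0//; lra.
Qed.

(** Divided by [c k], the kernel [sqdot ^+ k] has mean 1 and concentrates on the diagonal as [k]
    grows. Averaging [f] against it yields a combination of monomials by [sqdotX]. *)
Lemma monomial_density (f : X -> R) e : continuous f -> 0 < e ->
  exists k (a : {ffun 'I_k -> 'I_n.+1 * 'I_n.+1} -> R),
    forall x, `|f x - \sum_J a J * monomial J x| <= e.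
Proof.
move=> cf e0; have bf := bm_continuous cf; have [_ [M0 fM0]] := bf.
pose M := `|M0| + 1.
have M1 : 0 < M by rewrite ltr_wpDl.
have fM x : `|f x| <= M.
  by rewrite (le_trans (fM0 x))// /M (le_trans (ler_norm _))// lerDl.
have [r' r'0 fr'] := continuous_cap cf (divr_gt0 e0 (@ltr0n R 2)).
pose r := Num.min r' 1.
have r0 : 0 < r by rewrite lt_min r'0 ltr01.
have r1 : r <= 1 by rewrite ge_min lexx orbT.
have fr x y : 1 - sqdot x y < r -> `|f x - f y| < e / 2.
  by move=> h; apply: fr'; rewrite (lt_le_trans h)// ge_min lexx.
have [|m m0 cm] := @isotropic_moment_lb (r / 2); first by apply/andP; split; lra.
(* Off the cap of radius [r] the kernel is at most (1 - r)^k, while [c k] is at least m (1 - r/2)^k;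
   [t] is the ratio of the bases. *)
pose t := (1 - r) / (1 - r / 2).
have t0 : 0 <= t by rewrite divr_ge0//; lra.
have t1 : `|t| < 1 by rewrite ger0_norm// ltr_pdivrMr; lra.
have [k tk] : exists k, t ^+ k < e / 2 / (2 * M / m).
  have e2 : 0 < e / 2 / (2 * M / m) by rewrite !divr_gt0// mulr_gt0.
  have /cvgrPdist_lt/(_ _ e2)[k _ /(_ k (leqnn _))] := cvg_expr t1.
  by rewrite sub0r normrN ger0_norm ?exprn_ge0// => tk; exists k.
have r2 : 0 < (1 - r / 2) ^+ k by rewrite exprn_gt0//; lra.
have ck : 0 < c k by apply: lt_le_trans (cm k); rewrite mulr_gt0.
have bkf x : bounded_measurable (fun y => sqdot x y ^+ k * f y).
  by apply: bmM => //; exact: bm_sqdotrX.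
exists k, (fun J => mean sigma (fun y => monomial J y * f y) / c k) => x.
have -> : \sum_(J : {ffun 'I_k -> 'I_n.+1 * 'I_n.+1}) mean sigma (fun y => monomial J y * f y) / c k * monomial J x =
    (c k)^-1 * mean sigma (fun y => sqdot x y ^+ k * f y).
  have -> : (fun y => sqdot x y ^+ k * f y) = fun y =>
      \sum_(J : {ffun 'I_k -> 'I_n.+1 * 'I_n.+1}) monomial J x * (monomial J y * f y).
    by apply/funext => y; rewrite sqdotX mulr_suml; apply: eq_bigr => J _; ring.
  rewrite mean_sum => [|J]; last by apply/bmZ/bmM => //; exact: bm_monomial.
  rewrite mulr_sumr; apply: eq_bigr => J _.
  rewrite meanZ; last by apply/bmM => //; exact: bm_monomial.
  by ring.
have -> : f x = (c k)^-1 * mean sigma (fun y => f x * sqdot x y ^+ k).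
  rewrite meanZ; last exact: bm_sqdotrX.
  by rewrite sigmac mulrCA mulVf ?mulr1// gt_eqF.
rewrite -mulrBr normrM ger0_norm ?invr_ge0 ?(ltW ck)//.
rewrite ler_pdivrMl// -meanB//; last exact/bmZ/bm_sqdotrX.
have cke : c k * e = mean sigma (fun y => e / 2 * sqdot x y ^+ k) + c k * (e / 2).
  rewrite meanZ ?sigmac; last exact: bm_sqdotrX.
  by field.
rewrite cke; apply: (@le_trans _ _ (mean sigma (fun y => e / 2 * sqdot x y ^+ k) + 2 * M * (1 - r) ^+ k)); last first.
  rewrite lerD2l; apply: le_trans (_ : (1 - r / 2) ^+ k * m * (e / 2) <= _); last first.
    by rewrite ler_pM2r ?cm// divr_gt0.
  have -> : 2 * M * (1 - r) ^+ k = (1 - r / 2) ^+ k * m * (2 * M / m * t ^+ k).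
    rewrite /t expr_div_n; field; rewrite (gt_eqF r2) (gt_eqF m0)//.
  rewrite ler_pM2l ?mulr_gt0// mulrC -ler_pdivlMr ?divr_gt0 ?mulr_gt0//.
  exact: ltW.
have bd : bounded_measurable (fun y => f x * sqdot x y ^+ k - sqdot x y ^+ k * f y).
  by apply: bmB => //; exact/bmZ/bm_sqdotrX.
have be : bounded_measurable (fun y => e / 2 * sqdot x y ^+ k + 2 * M * (1 - r) ^+ k).
  by apply: bmD; [exact/bmZ/bm_sqdotrX|exact: bm_cst].
have dle y : `|f x * sqdot x y ^+ k - sqdot x y ^+ k * f y| <=
     e / 2 * sqdot x y ^+ k + 2 * M * (1 - r) ^+ k.
  have sk0 : 0 <= sqdot x y ^+ k by rewrite exprn_ge0// sqdot_ge0.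
  rewrite mulrC -mulrBr normrM ger0_norm// mulrC.
  (* Near [x] the continuity of [f] applies; elsewhere the crude bound [2 * M] multiplies a small
     kernel. *)
  have [xy|xy] := ltP (1 - sqdot x y) r.
    rewrite -[X in X <= _]addr0 lerD// ?ler_wpM2r// ?(ltW (fr _ _ xy))//.
    by rewrite mulr_ge0 ?exprn_ge0 ?subr_ge0// mulr_ge0// ltW.
  rewrite -[X in X <= _]add0r lerD// ?mulr_ge0//; first by rewrite ltW// divr_gt0.
  apply: ler_pM => //.
    by rewrite (le_trans (ler_normB _ _))// mulr_natl mulr2n lerD.
  by apply: lerXn2r; rewrite ?nnegrE ?sqdot_ge0 ?subr_ge0//; lra.
rewrite -[X in _ <= _ + X](mean_cst sigma) -meanD; [|exact/bmZ/bm_sqdotrX|exact: bm_cst].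
rewrite ler_norml; apply/andP; split.
  rewrite lerNl -[X in X <= _]add0r -(mean_cst sigma 0) -meanB//; last exact: bm_cst.
  apply: mean_le => // [|y]; first by apply: bmB => //; exact: bm_cst.
  by rewrite sub0r; have := dle y; rewrite ler_norml lerNl => /andP[].
by apply: mean_le => // y; have := dle y; rewrite ler_norml => /andP[].
Qed.

(** By [moment_discrepancy], convergence of the energies forces convergence of every moment, and
    combinations of monomials are uniformly dense. *)
Lemma weakly_converges_isotropic (mu_ : nat -> probability X R) :
  (forall k, double_mean (mu_ j) (mu_ j) (fun z => sqdot z.1 z.2 ^+ k) @[j --> \oo] --> c k) ->
  weakly_converges mu_ sigma.
Proof.
move=> mu_c f cf; have bf := bm_continuous cf.
under eq_fun do rewrite integral_mean//; rewrite integral_mean//.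
apply: cvg_EFin; first exact: nearW.
apply/cvgrPdist_le => /= e e0.
have e3 : 0 < e / 3 by rewrite divr_gt0.
have [k [a fa]] := monomial_density cf e3.
pose A := \sum_J `|a J| + 1.
have A0 : 0 < A by rewrite ltr_wpDl// sumr_ge0.
(* A bound [eta ^+ 2] on the sum of squares bounds each moment difference by [eta], and [A]
   dominates the sum of the coefficients. *)
pose eta := e / 3 / A.
have eta0 : 0 < eta by rewrite divr_gt0.
have eta2 : 0 < eta ^+ 2 by rewrite exprn_gt0.
have /cvgrPdist_lt/(_ _ eta2) near_eta := mu_c k.
near=> j.
have Ej : `|c k - double_mean (mu_ j) (mu_ j) (fun z => sqdot z.1 z.2 ^+ k)| < eta ^+ 2.
  by near: j; exact: near_eta.
have dJ (J : {ffun 'I_k -> 'I_n.+1 * 'I_n.+1}) : `|moment (mu_ j) J - moment sigma J| <= eta.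
  rewrite -(@ler_pXn2r _ 2)// ?nnegrE// ?(ltW eta0)// real_normK ?num_real//.
  apply: le_trans (ltW Ej); rewrite distrC ger0_norm; last first.
    by rewrite subr_ge0; exact: moment_discrepancy_ge0.
  rewrite -(moment_discrepancy sigmac) (bigD1 J)//= lerDl.
  by apply: sumr_ge0 => L _; exact: sqr_ge0.
pose g x := \sum_J a J * monomial J x.
have bg : bounded_measurable g by apply: bm_sum => J; exact/bmZ/bm_monomial.
have gE nu : mean nu g = \sum_J a J * moment nu J.
  rewrite mean_sum => [|J]; last exact/bmZ/bm_monomial.
  by apply: eq_bigr => J _; rewrite meanZ//; exact: bm_monomial.
have h1 := mean_dist sigma bf bg fa.
have h2 := mean_dist (mu_ j) bf bg fa.
have h3 : `|mean sigma g - mean (mu_ j) g| <= e / 3.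
  rewrite !gE -sumrB (le_trans (ler_norm_sum _ _ _))//.
  apply: (@le_trans _ _ (\sum_J `|a J| * eta)).
    by apply: ler_sum => J _; rewrite -mulrBr normrM ler_wpM2l// distrC.
  rewrite -mulr_suml /eta mulrCA ger_pMr ?divr_gt0//.
  by rewrite ler_pdivrMr// mul1r lerDl.
have -> : mean sigma f - mean (mu_ j) f = (mean sigma f - mean sigma g) +
   (mean sigma g - mean (mu_ j) g) - (mean (mu_ j) f - mean (mu_ j) g) by ring.
rewrite (le_trans (ler_normB _ _))// (le_trans (lerD (ler_normD _ _) (lexx _)))//.
by lra.
Unshelve. all: by end_near. Qed.

(** The constant sequence [mu] converges weakly to [sigma], so both give the same mean to continuous
    functions. *)
Lemma isotropic_unique mu :
  (forall k, double_mean mu mu (fun z => sqdot z.1 z.2 ^+ k) = c k) ->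
  same_measure mu sigma.
Proof.
move=> muc; apply: same_measure_continuous => f cf.
have bf := bm_continuous cf.
apply: EFin_inj; rewrite -!integral_mean//.
have /(_ f cf) : weakly_converges (fun=> mu) sigma.
  by apply: weakly_converges_isotropic => k; rewrite muc; exact: cvg_cst.
by apply: cvg_unique => //; exact: cvg_cst.
Qed.

End density.
End isotropic_consequences.

Lemma bernoulli_onem (R : realType) (r : R) k : 0 <= r <= 1 -> 1 - k%:R * r <= (1 - r) ^+ k.
Proof.
move=> /andP[r0 r1]; elim: k => [|k ih]; first by rewrite mul0r subr0 expr0.
rewrite exprS; apply: (@le_trans _ _ ((1 - r) * (1 - k%:R * r))).
  rewrite -natr1; have : 0 <= (k%:R : R) by []; nra.
by rewrite ler_wpM2l// subr_ge0.
Qed.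

(** * Small moments, small caps and nonatomicity *)

Section isotropic_nonatomic.
Context (R : realType) (n : nat).
Hypothesis n_gt0 : (0 < n)%N.
Local Notation X := (RP R n).
Implicit Types (x y : X) (mu nu : probability X R).

(** The lines through (1, i, 0, ..., 0) are told apart by the projection entry 1/(1 + i^2). *)
Lemma RP_infinite : exists f : nat -> X, injective f.
Proof.
case: n n_gt0 => // m _.
pose s (i : nat) : R := 1 + i%:R ^+ 2.
have s0 i : 0 < s i by rewrite ltr_pwDl// sqr_ge0.
pose u i : 'rV[R]_m.+2 :=
  (Num.sqrt (s i))^-1 *: \row_j (if j == 0 then 1 else if j == 1 then i%:R else 0).
have u1 i : dotp (u i) (u i) = 1.
  rewrite /dotp !big_ord_recl big1 => [|j _]; last by rewrite !mxE /= !mulr0.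
  rewrite !mxE/= addr0.
  have -> : (Num.sqrt (s i))^-1 * 1 * ((Num.sqrt (s i))^-1 * 1) +
      (Num.sqrt (s i))^-1 * i%:R * ((Num.sqrt (s i))^-1 * i%:R) =
      (Num.sqrt (s i) ^+ 2)^-1 * s i.
    by rewrite /s -exprVn; ring.
  by rewrite sqr_sqrtr ?(ltW (s0 i))// mulVf// gt_eqF.
exists (fun i => line_of (u i)) => i j /(congr1 (proj_entry (0, 0))).
rewrite !proj_entry_line_of// !mxE/= !mulr1 -!expr2 !exprVn !sqr_sqrtr ?(ltW (s0 _))//.
move/invr_inj/addrI/eqP; rewrite eqrXn2// => /eqP.
by move/eqP; rewrite eqr_nat => /eqP.
Qed.

Section isotropic.
Variables (sigma : probability X R) (c : nat -> R).
Hypothesis sigmac : forall k x, mean sigma (fun y => sqdot x y ^+ k) = c k.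

(** Nonnegativity of the moment discrepancy for the unnormalized counting measure of the points. *)
Lemma isotropic_moment_ub N k (x_ : 'I_N -> X) :
  N%:R ^+ 2 * c k <= \sum_i \sum_j sqdot (x_ i) (x_ j) ^+ k.
Proof.
have ck : \sum_(J : {ffun 'I_k -> 'I_n.+1 * 'I_n.+1}) moment sigma J ^+ 2 = c k.
  under eq_bigr do rewrite expr2.
  by rewrite -double_mean_sqdotX (double_mean_isotropicr sigmac).
have cx i : \sum_(J : {ffun 'I_k -> 'I_n.+1 * 'I_n.+1}) monomial J (x_ i) * moment sigma J = c k.
  by rewrite -mean_sqdotX sigmac.
rewrite -subr_ge0.
have -> : \sum_i \sum_j sqdot (x_ i) (x_ j) ^+ k - N%:R ^+ 2 * c k =
    \sum_(J : {ffun 'I_k -> 'I_n.+1 * 'I_n.+1})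
      (\sum_i monomial J (x_ i) - N%:R * moment sigma J) ^+ 2.
  under [RHS]eq_bigr do rewrite sqrrB exprMn.
  rewrite big_split/= -mulr_sumr ck sumrB sumrMnl.
  have -> : \sum_(J : {ffun 'I_k -> 'I_n.+1 * 'I_n.+1}) (\sum_i monomial J (x_ i)) *
     (N%:R * moment sigma J) = N%:R ^+ 2 * c k.
    under eq_bigr do rewrite mulr_suml.
    rewrite exchange_big/=.
    under eq_bigr do (under eq_bigr do rewrite mulrCA; rewrite -mulr_sumr cx).
    by rewrite sumr_const card_ord -mulr_natl; ring.
  have -> : \sum_(J : {ffun 'I_k -> 'I_n.+1 * 'I_n.+1}) (\sum_i monomial J (x_ i)) ^+ 2 =
      \sum_i \sum_j sqdot (x_ i) (x_ j) ^+ k.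
    under eq_bigr do rewrite expr2 big_distrlr/=.
    rewrite exchange_big/=; apply: eq_bigr => i _.
    by rewrite exchange_big/=; apply: eq_bigr => j _; rewrite sqdotX.
  by ring.
by apply: sumr_ge0 => J _; exact: sqr_ge0.
Qed.

(** For N distinct lines, [isotropic_moment_ub] gives [c k] at most 1/N + rho^k, where rho < 1 is
    the largest off-diagonal [sqdot]. First N is chosen, then [k]. *)
Lemma isotropic_moment_small e : 0 < e -> exists k, c k < e.
Proof.
move=> e0; have [f finj] := RP_infinite.
pose N := (Num.trunc (2 / e)).+1.
have Ne : N%:R^-1 < e / 2.
  rewrite -[X in _ < X]invrK ltf_pV2 ?posrE ?invr_gt0 ?divr_gt0 ?ltr0n//.
  by rewrite invf_div; exact: truncnS_gt.
pose rho : R := \big[Num.max/0]_(z : 'I_N * 'I_N | z.1 != z.2) sqdot (f z.1) (f z.2).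
have rho1 : rho < 1.
  apply/bigmax_ltP; split=> // -[i j] /= ij; apply: sqdot_lt1 => /finj/val_inj.
  by apply/eqP.
have rho0 : 0 <= rho by apply: bigmax_ge_id.
have rholt : `|rho| < 1 by rewrite ger0_norm.
have e2 : 0 < e / 2 by rewrite divr_gt0.
have [k rhok] : exists k, rho ^+ k < e / 2.
  have /cvgrPdist_lt/(_ _ e2)[k _ /(_ k (leqnn _))] := cvg_expr rholt.
  by rewrite sub0r normrN ger0_norm ?exprn_ge0// => tk; exists k.
exists k; have N0 : 0 < N%:R :> R by rewrite ltr0n.
have := isotropic_moment_ub k (fun i : 'I_N => f i).
have : \sum_(i < N) \sum_(j < N) sqdot (f i) (f j) ^+ k <= N%:R + N%:R ^+ 2 * rho ^+ k.
  have -> : N%:R + N%:R ^+ 2 * rho ^+ k = \sum_(i < N) (1 + \sum_(j < N) rho ^+ k).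
    rewrite big_split/= !sumr_const !card_ord; rewrite -[X in _ = _ + X]mulr_natl -[(rho ^+ k) *+ N]mulr_natl; ring.
  apply: ler_sum => i _; rewrite (bigD1 i)//= sqdotxx expr1n lerD2l.
  rewrite [leRHS](bigD1 i)//= ler_wpDl ?exprn_ge0//.
  apply: ler_sum => j ji; apply: lerXn2r; rewrite ?nnegrE ?sqdot_ge0//.
  by apply: (bigmax_sup (i, j)) => //=; rewrite eq_sym.
move=> /[swap] /le_trans/[apply].
have -> : N%:R + N%:R ^+ 2 * rho ^+ k = N%:R ^+ 2 * (N%:R^-1 + rho ^+ k).
  by field; rewrite gt_eqF.
rewrite ler_pM2l ?exprn_gt0// => /le_lt_trans; apply.
by move: Ne; set t := _^-1; lra.
Qed.

(** With r = 1/(2(k+1)), Bernoulli's inequality makes [sqdot ^+ k] at least 1/2 on the cap, whose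
    mass is then at most [2 * c k]. *)
Lemma isotropic_cap_small (e : R) : 0 < e ->
  exists2 r : R, 0 < r & forall x, mean sigma \1_(cap x r) < e.
Proof.
move=> e0; have e2 : 0 < e / 2 by rewrite divr_gt0.
have [k cke] := isotropic_moment_small e2.
pose r : R := (2 * k.+1%:R)^-1.
have k0 : 0 < k.+1%:R :> R by rewrite ltr0n.
have r0 : 0 < r by rewrite invr_gt0 mulr_gt0.
have kr : k.+1%:R * r = 1 / 2 by rewrite /r; field; rewrite gt_eqF.
have r1 : r <= 1 / 2.
  by rewrite -kr ler_peMl ?ler1n// ltW.
have rk : 1 / 2 <= (1 - r) ^+ k.
  apply: le_trans (bernoulli_onem k _); last by apply/andP; split; lra.
  by move: kr; rewrite -natr1; nra.
exists r => // x; have : (1 - r) ^+ k * mean sigma \1_(cap x r) <= c k.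
  rewrite -(sigmac k x) -meanZ; last exact: bm_cap.
  apply: mean_le => [| |y].
  - by apply: bmZ; exact: bm_cap.
  - exact: bm_sqdotrX.
  rewrite indicE; case: (boolP (y \in _)) => [|_]; last first.
    by rewrite mulr0 exprn_ge0// sqdot_ge0.
  by rewrite inE /cap/= mulr1 => xy; apply: lerXn2r; rewrite ?nnegrE ?sqdot_ge0//; lra.
have : 0 <= mean sigma \1_(cap x r) by apply: mean_ge0 => y; rewrite indicE.
by nra.
Qed.

(** Finitely many caps, each of smaller mass than [A], cover the space; one of them meets [A] in
    positive mass. *)
Lemma isotropic_nonatomic : nonatomic sigma.
Proof.
move=> A mA A0.
have mA0 : 0 < mean sigma \1_A by rewrite -lte_fin mean_indic.
have [r r0 capA] := isotropic_cap_small mA0.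
have [s scover] := @cap_cover R n r r0.
have mAx x : measurable (A `&` cap x r) by apply: measurableI => //; exact: cap_measurable.
have [x m0] : exists x, 0 < mean sigma \1_(A `&` cap x r).
  apply: contrapT => /forallNP h.
  have : \sum_(x <- s) mean sigma \1_(A `&` cap x r) <= 0.
    by apply: sumr_le0 => x _; rewrite leNgt; apply/negP/h.
  rewrite -mean_sum => [|x]; last exact: bm_indic.
  rewrite leNgt => /negP; apply; apply: lt_le_trans mA0 _.
  apply: mean_le => [| |y].
  - exact: bm_indic.
  - by apply: bm_sum => x; exact: bm_indic.
  have [x xs xy] := scover y.
  rewrite (big_rem x)//= indicE [\1__ y]indicE in_setI (mem_set xy) andbT lerDl.
  by apply: sumr_ge0 => z _; rewrite indicE.
exists (A `&` cap x r); split => //.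
  by rewrite -mean_indic// lte_fin.
rewrite -!mean_indic// lte_fin; apply: le_lt_trans (capA x).
apply: mean_le => [| |y]; [exact: bm_indic|exact: bm_cap|].
by rewrite !indicE in_setI; case: (y \in A); rewrite //= lexx.
Qed.

End isotropic.
End isotropic_nonatomic.

(** * Existence of an isotropic measure *)

Section angular_measure.
Context (R : realType).
Local Notation pi := (pi : R).
Let pi0 : 0 < pi := pi_gt0 R.
Let U : probability (measurableTypeR R) R := uniform_prob pi0.

Lemma uniform_mean (f : R -> R) : bounded_measurable (T := measurableTypeR R) f ->
  (forall x, 0 <= f x) ->
  (mean U f)%:E = (pi^-1%:E * \int[lebesgue_measure]_(x in `[0%R, pi]) (f x)%:E)%E.
Proof.
by move=> bf f0; rewrite -integral_mean// integral_uniform ?subr0//;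
  apply/measurable_EFinP; case: bf.
Qed.

Lemma bm_continuous_bounded (f : R -> R) (M : R) : continuous f ->
  (forall x, `|f x| <= M) -> bounded_measurable (T := measurableTypeR R) f.
Proof. by move=> cf fM; split; [exact: continuous_measurable_fun|exists M]. Qed.

Lemma uniform_mean_derive (F f : R -> R) (M : R) :
  (forall x : R, is_derive x (1 : R) F (f x)) -> continuous f ->
  (forall x, `|f x| <= M) -> mean U f = pi^-1 * (F pi - F 0).
Proof.
move=> Ff cf fM; have bf := bm_continuous_bounded cf fM.
(* Adding the bound [M] makes the integrand nonnegative, as [uniform_mean] requires. *)
pose g x := f x + M; pose G x := F x + M * x.
have cg : continuous g by move=> x; exact: (continuousD (cf x) (@cst_continuous R R M x)).
have dG (x : R) : is_derive x (1 : R) G (g x).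
  have h : is_derive x (1 : R) (fun y : R => M * y) M.
    by have := is_deriveZ M (is_derive_id x (1 : R)); rewrite scaler1.
  exact: is_deriveD.
have bM := @bm_cst _ (measurableTypeR R) R M.
have : (mean U g)%:E = (pi^-1 * (G pi - G 0))%:E.
  rewrite uniform_mean; last 2 first.
  - exact: bmD.
  - by move=> x; rewrite /g -lerBlDr sub0r; have := fM x; rewrite ler_norml => /andP[].
  rewrite (@continuous_FTC2 _ g G)//.
  - exact: continuous_subspaceT.
  - split=> [x _||]; first by have [] := dG x.
    + by apply: cvg_at_right_filter; apply: differentiable_continuous; apply/derivable1_diffP; have [] := dG 0.
    + by apply: cvg_at_left_filter; apply: differentiable_continuous; apply/derivable1_diffP; have [] := dG pi.
  - by move=> x _; rewrite derive1E; have [] := dG x.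
move=> []; rewrite /g meanD// mean_cst /G => h.
have shift (p a b : R) : p != 0 -> p^-1 * (a + M * p - (b + M * 0)) = p^-1 * (a - b) + M.
  by move=> p0; field.
by apply: (addIr M); rewrite h shift// gt_eqF.
Qed.

Lemma uniform_mean_eq (f g : R -> R) : bounded_measurable (T := measurableTypeR R) f ->
  bounded_measurable (T := measurableTypeR R) g ->
  (forall x, 0 <= x <= pi -> f x = g x) -> mean U f = mean U g.
Proof.
move=> bf bg fg; have [_ [M fM]] := bf; have [_ [N gN]] := bg.
have M0 : 0 <= M by rewrite (le_trans _ (fM 0)).
have N0 : 0 <= N by rewrite (le_trans _ (gN 0)).
have bMN := @bm_cst _ (measurableTypeR R) R (M + N).
apply: (addIr (M + N)); rewrite -{1 2}[M + N](mean_cst U) -!meanD//.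
apply: EFin_inj; rewrite !uniform_mean.
- congr (_ * _)%E; apply: eq_integral => x; rewrite inE/= in_itv/= => x0.
  by rewrite fg.
- exact: bmD.
- by move=> x; have := gN x; rewrite ler_norml => /andP[]; lra.
- exact: bmD.
- by move=> x; have := fM x; rewrite ler_norml => /andP[]; lra.
Qed.

Let W j m := mean U (fun x => cos x ^+ j * sin x ^+ m).

Let bm_cos : bounded_measurable (T := measurableTypeR R) (@cos R).
Proof. by apply: (@bm_continuous_bounded _ 1); [exact: continuous_cos|move=> x; rewrite ler_norml cos_geN1 cos_le1]. Qed.

Let bm_sin : bounded_measurable (T := measurableTypeR R) (@sin R).
Proof. by apply: (@bm_continuous_bounded _ 1); [exact: continuous_sin|move=> x; rewrite ler_norml sin_geN1 sin_le1]. Qed.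

Let bm_cossin j m : bounded_measurable (T := measurableTypeR R) (fun x => cos x ^+ j * sin x ^+ m).
Proof. by apply: bmM; exact: bmX. Qed.

Let continuous_cossin j m : continuous (fun x : R => cos x ^+ j * sin x ^+ m).
Proof.
move=> x; apply: (@continuousM _ _ (fun x => cos x ^+ j) (fun x => sin x ^+ m)).
  by apply: continuous_exp; exact: continuous_cos.
by apply: continuous_exp; exact: continuous_sin.
Qed.

Let cossin_le1 j m x : `|cos x ^+ j * sin x ^+ m| <= 1 :> R.
Proof.
rewrite normrM !normrX mulr_ile1 ?exprn_ge0// exprn_ile1//.
  by rewrite ler_norml cos_geN1 cos_le1.
by rewrite ler_norml sin_geN1 sin_le1.
Qed.

Let W1 m : W 1 m = 0.
Proof.
have : mean U (fun x => m.+1%:R * (cos x ^+ 1 * sin x ^+ m)) = pi^-1 * (sin pi ^+ m.+1 - sin 0 ^+ m.+1).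
  apply: (@uniform_mean_derive (fun x => sin x ^+ m.+1) _ m.+1%:R) => x.
  - rewrite -exprfctE; apply: is_derive_eq (is_deriveX m.+1 (is_derive_sin x)) _.
    by rewrite /= /GRing.scale/= expr1; ring.
  - exact: (continuousM (@cst_continuous R R m.+1%:R x) (@continuous_cossin 1 m x)).
  - by rewrite normrM ger0_norm// ler_piMr// cossin_le1.
rewrite sinpi sin0 subrr mulr0 meanZ// => /eqP; rewrite mulf_eq0 pnatr_eq0/=.
by move/eqP.
Qed.

(** Integration by parts: [cos ^+ j.+1 * sin ^+ m.+1] vanishes at 0 and pi. *)
Let Wrec j m : m.+1%:R * W j.+2 m = j.+1%:R * W j m.+2.
Proof.
pose f x : R := m.+1%:R * (cos x ^+ j.+2 * sin x ^+ m) - j.+1%:R * (cos x ^+ j * sin x ^+ m.+2).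
have : mean U f = pi^-1 * (cos pi ^+ j.+1 * sin pi ^+ m.+1 - cos 0 ^+ j.+1 * sin 0 ^+ m.+1).
  apply: (@uniform_mean_derive (fun x => cos x ^+ j.+1 * sin x ^+ m.+1) _ (m.+1%:R + j.+1%:R)) => x.
  - have hs := is_deriveX m.+1 (is_derive_sin x); have hc := is_deriveX j.+1 (is_derive_cos x).
    rewrite -[fun _ => _]/((fun x => cos x ^+ j.+1) * (fun x => sin x ^+ m.+1)) -!exprfctE.
    apply: is_derive_eq (is_deriveM hc hs) _.
    by rewrite /f /= /GRing.scale/= !fctE !exprS; ring.
  - have c1 := continuousM (@cst_continuous R R m.+1%:R x) (@continuous_cossin j.+2 m x).
    have c2 := continuousM (@cst_continuous R R j.+1%:R x) (@continuous_cossin j m.+2 x).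
    exact: (continuousB c1 c2).
  - rewrite (le_trans (ler_normB _ _))// lerD// normrM ger0_norm// ler_piMr// cossin_le1.
rewrite sinpi sin0 !exprS !mul0r !mulr0 subrr mulr0.
rewrite /f meanB ?meanZ//; [|exact: bmZ..].
by move/eqP; rewrite subr_eq0 => /eqP.
Qed.

Let W0rec m : m.+2%:R * W 0 m.+2 = m.+1%:R * W 0 m.
Proof.
have : W 0 m = W 2 m + W 0 m.+2.
  rewrite /W -meanD//; congr mean; apply/funext => x.
  have -> : sin x ^+ m.+2 = sin x ^+ m * sin x ^+ 2 by rewrite -exprD addn2.
  by rewrite !expr0 !mul1r cos2sin2; ring.
by have := Wrec 0 m; rewrite mul1r -[m.+2%:R]natr1 => <- ->; ring.
Qed.

Let W0gt0 m : 0 < W 0 m.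
Proof.
have W00 : W 0 0 = 1.
  by rewrite /W -[RHS](mean_cst U); congr mean; apply/funext => x; rewrite !expr0 mulr1.
have W01 : 0 < W 0 1.
  have -> : W 0 1 = pi^-1 * (- cos pi - - cos 0).
    apply: (@uniform_mean_derive (fun x => - cos x) _ 1) => x.
    - have := is_deriveN (is_derive_cos x); rewrite opprK expr0 mul1r expr1.
      exact.
    - exact: continuous_cossin.
    - exact: cossin_le1.
  by rewrite cospi cos0 mulr_gt0 ?invr_gt0//; lra.
suff : 0 < W 0 m /\ 0 < W 0 m.+1 by case.
elim: m => [|m [ih1 ih2]]; first by rewrite W00.
split=> //; have := W0rec m => h.
by rewrite -(@pmulr_rgt0 _ m.+2%:R)// h mulr_gt0.
Qed.

(** The density is proportional to |sin|^n, which is nonnegative everywhere and equals sin^n on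
    [0, pi]; it shifts [m] to [m + n] in [Wrec] and [W1]. *)
Lemma angular_measure n : exists tau : probability (measurableTypeR R) R,
  (forall j m, (m + n.+1)%:R * mean tau (fun x => cos x ^+ j.+2 * sin x ^+ m) =
     j.+1%:R * mean tau (fun x => cos x ^+ j * sin x ^+ m.+2)) /\
  forall m, mean tau (fun x => cos x ^+ 1 * sin x ^+ m) = 0.
Proof.
pose g x : R := (W 0 n)^-1 * `|sin x| ^+ n.
have babs : bounded_measurable (T := measurableTypeR R) (fun x => `|sin x| : R).
  apply: (@bm_continuous_bounded _ 1) => x.
    by apply: continuous_comp; [exact: continuous_sin|exact: norm_continuous].
  by rewrite normr_id ler_norml sin_geN1 sin_le1.
have bg : bounded_measurable (T := measurableTypeR R) g by apply/bmZ/bmX.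
have gE j m : mean U (fun x => g x * (cos x ^+ j * sin x ^+ m)) = (W 0 n)^-1 * W j (m + n)%N.
  rewrite /W -meanZ//; apply: uniform_mean_eq => [| |x x0pi].
  - by apply: bmM.
  - exact: bmZ.
  - by rewrite /g ger0_norm ?sin_ge0_pi// ?in_itv// exprD; ring.
have [||tau tauE] := @mean_density _ _ _ U g bg.
- by move=> x; rewrite mulr_ge0 ?invr_ge0 ?exprn_ge0// ltW.
- have := gE 0 0; rewrite add0n mulVf ?gt_eqF// => <-.
  by congr mean; apply/funext => x; rewrite !expr0 !mulr1.
exists tau; split=> [j m|m]; rewrite !tauE// !gE ?W1 ?mulr0//.
by rewrite mulrCA addnS Wrec !addSn mulrCA.
Qed.

End angular_measure.

(** * Moments of linear forms on the sphere *)

Section sphere_moments.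
Context (R : realType).

(** Of the uniform law on the sphere only this is kept: even moments of a linear form depend on its
    length alone. The recursion for [c] is what the induction on the dimension consumes. *)
Definition has_sphere_moments n d (T : measurableType d) (P : probability T R)
    (Y : 'I_n.+1 -> T -> R) (c : nat -> R) :=
  [/\ forall i, bounded_measurable (Y i),
      forall t, \sum_i Y i t ^+ 2 = 1,
      c 0%N = 1,
      forall k, c k.+1 * (n.+1 + k.*2)%:R = k.*2.+1%:R * c k &
      forall k (u : 'rV[R]_n.+1),
        mean P (fun t => (\sum_i u 0 i * Y i t) ^+ k.*2) = c k * dotp u u ^+ k].

Lemma sum_even_terms (f : nat -> R) k : (forall i, odd i -> f i = 0) ->
  \sum_(i < k.*2.+1) f i = \sum_(l < k.+1) f l.*2.
Proof.
move=> f0; elim: k => [|k ih]; first by rewrite !big_ord1.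
rewrite doubleS 2!big_ord_recr/= ih [RHS]big_ord_recr/= [f k.*2.+1]f0 ?addr0//=.
by rewrite odd_double.
Qed.

(** This and [bin_rec] compare the indices (p+1, l) and (p, l+1), which have the same sum, for the
    induction in [binV]. *)
Lemma bin_double_rec p l :
  (p.+1%:R * p.*2.+1%:R) * 'C((p.+1 + l).*2, l.*2)%:R =
  (l.+1%:R * l.*2.+1%:R) * 'C((p + l.+1).*2, l.+1.*2)%:R :> R.
Proof.
set N := (p.+1 + l).*2.
have -> : (p + l.+1).*2 = N by rewrite addnS.
have h1 := mul_bin_left N l.*2; have h2 := mul_bin_left N l.*2.+1.
have e1 : (N - l.*2 = p.+1.*2)%N by rewrite /N doubleD addnK.
have e2 : (N - l.*2.+1 = p.*2.+1)%N by rewrite subnS e1 doubleS.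
rewrite e1 in h1; rewrite e2 in h2.
have {}h1 : l.*2.+1%:R * 'C(N, l.*2.+1)%:R = 2 * p.+1%:R * 'C(N, l.*2)%:R :> R.
  by rewrite -natrM h1 -mul2n !natrM.
have {}h2 : 2 * l.+1%:R * 'C(N, l.*2.+2)%:R = p.*2.+1%:R * 'C(N, l.*2.+1)%:R :> R.
  by rewrite -!natrM -h2 mul2n doubleS.
apply: (@mulfI _ 2) => //.
rewrite [in RHS]doubleS.
have -> : 2 * (l.+1%:R * l.*2.+1%:R * 'C(N, l.*2.+2)%:R) =
  l.*2.+1%:R * (2 * l.+1%:R * 'C(N, l.*2.+2)%:R) :> R by ring.
rewrite h2.
transitivity (p.*2.+1%:R * (2 * p.+1%:R * 'C(N, l.*2)%:R) : R); first by ring.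
by rewrite -h1; ring.
Qed.

Lemma bin_rec p l :
  p.+1%:R * 'C(p.+1 + l, l)%:R = l.+1%:R * 'C(p + l.+1, l.+1)%:R :> R.
Proof.
by rewrite -!natrM [in RHS]addnS -addSn mul_bin_left addnK.
Qed.

(* The n+1-dimensional sphere is obtained from the n-dimensional one as
   (cos t, sin t * y), where t has density proportional to sin^n on [0, pi]. *)
Lemma sphere_moments_exist n : exists d (T : measurableType d)
  (P : probability T R) (Y : 'I_n.+1 -> T -> R) (c : nat -> R),
  has_sphere_moments P Y c.
Proof.
elim: n => [|n [d [T [P [Y [c [bY Y1 c0 crec cE]]]]]]].
  (* In dimension one the single point 1 replaces the pair 1, -1, as even moments do not see the
     sign. *)
  exists _, (measurableTypeR R), (@dirac _ (measurableTypeR R) (0 : R) R), (fun _ _ => 1), (fun=> 1); split=> //.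
  - by move=> _; exact: bm_cst.
  - by move=> _; rewrite big_ord1 expr1n.
  - by move=> k; rewrite mulrC add1n.
  - move=> k u; rewrite -[LHS]/(mean _ (fun=> _)) mean_cst big_ord1 mulr1 mul1r.
    by rewrite /dotp big_ord1 -expr2 -exprM mul2n.
have [tau [Vrec Vodd]] := angular_measure R n.
pose V j m := mean tau (fun x => cos x ^+ j * sin x ^+ m).
have {}Vrec j m : (m + n.+1)%:R * V j.+2 m = j.+1%:R * V j m.+2 := Vrec j m.
have {}Vodd m : V 1%N m = 0 := Vodd m.
have bcos : bounded_measurable (T := measurableTypeR R) (@cos R).
  by apply: (@bm_continuous_bounded _ _ 1); [exact: continuous_cos|move=> x; rewrite ler_norml cos_geN1 cos_le1].
have bsin : bounded_measurable (T := measurableTypeR R) (@sin R).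
  by apply: (@bm_continuous_bounded _ _ 1); [exact: continuous_sin|move=> x; rewrite ler_norml sin_geN1 sin_le1].
have bcs j m : bounded_measurable (T := measurableTypeR R) (fun x : R => cos x ^+ j * sin x ^+ m).
  by apply: bmM; exact: bmX.
have V0 i m : odd i -> V i m = 0.
  move=> oi; rewrite -(odd_double_half i) oi add1n.
  elim: i./2 m => [|k ih] m; first exact: Vodd.
  apply: (@mulfI _ (m + n.+1)%:R); first by rewrite pnatr_eq0 addnS.
  by rewrite mulr0 doubleS Vrec ih mulr0.
have V0rec m : (m + n.+2)%:R * V 0 m.+2 = (m + n.+1)%:R * V 0 m.
  have VD : V 0 m = V 2 m + V 0 m.+2.
    rewrite /V -meanD//; congr mean; apply/funext => x.
    have -> : sin x ^+ m.+2 = sin x ^+ m * sin x ^+ 2 by rewrite -exprD addn2.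
    by rewrite !expr0 !mul1r cos2sin2; ring.
  by have := Vrec 0%N m; rewrite mul1r addnS -natr1 VD mulrDr => ->; ring.
(* This is the moment of a unit form that ignores the new coordinate. *)
pose c' k := V 0 k.*2 * c k.
(* The coefficients of a^(2p) |v|^(2l) agree in the mean of (a cos + sin L)^(2(p+l)) and in c'(p+l)
   (a^2 + |v|^2)^(p+l). The induction on [p] trades two powers of the cosine for two of the sine. *)
have binV p l : V p.*2 l.*2 * c l * 'C((p + l).*2, l.*2)%:R =
    'C(p + l, l)%:R * c' (p + l)%N.
  elim: p l => [|p ih] l; first by rewrite add0n !binn /c' mulr1 mul1r.
  have := ih l.+1; rewrite -addSnnS => ihl.
  have vr := Vrec p.*2 l.*2.
  have cr := crec l.
  have b2 := bin_double_rec p l; have b1 := bin_rec p l.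
  rewrite -addSnnS in b2 b1.
  have nz1 : (l.*2 + n.+1)%:R != 0 :> R by rewrite pnatr_eq0 addnS.
  have nz2 : p.+1%:R != 0 :> R by rewrite pnatr_eq0.
  have nz3 : p.*2.+1%:R != 0 :> R by rewrite pnatr_eq0.
  rewrite addnC in cr.
  apply: (mulfI nz1); apply: (mulfI nz2); apply: (mulfI nz3).
  rewrite doubleS.
  transitivity (((l.*2 + n.+1)%:R * V p.*2.+2 l.*2) * c l *
    (p.+1%:R * p.*2.+1%:R * 'C((p.+1 + l).*2, l.*2)%:R)); first by ring.
  rewrite vr b2.
  transitivity (p.*2.+1%:R * l.+1%:R * (l.*2.+1%:R * c l) * V p.*2 l.*2.+2 *
     'C((p.+1 + l).*2, l.+1.*2)%:R); first by ring.
  rewrite -cr.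
  transitivity (p.*2.+1%:R * l.+1%:R * (l.*2 + n.+1)%:R * (V p.*2 l.+1.*2 * c l.+1 *
     'C((p.+1 + l).*2, l.+1.*2)%:R)); first by rewrite !doubleS; ring.
  rewrite ihl.
  transitivity (p.*2.+1%:R * (l.*2 + n.+1)%:R * (l.+1%:R * 'C(p.+1 + l, l.+1)%:R) * c' (p.+1 + l)%N);
    first by ring.
  by rewrite -b1; ring.
pose Y' (i : 'I_n.+2) (z : measurableTypeR R * T) : R :=
  if unlift ord0 i is Some j then sin z.1 * Y j z.2 else cos z.1.
have Y'0 z : Y' ord0 z = cos z.1 by rewrite /Y' unlift_none.
have Y'S j z : Y' (lift ord0 j) z = sin z.1 * Y j z.2 by rewrite /Y' liftK.
exists _, (measurableTypeR R * T)%type, (tau \x P)%E, Y', c'; split.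
- move=> i; rewrite /Y'; case: unliftP => [j _|_].
    by apply: bmM; [exact: (bm_fst _ bsin)|exact: (bm_snd _ (bY j))].
  exact: (bm_fst _ bcos).
- move=> z; rewrite big_ord_recl Y'0.
  under eq_bigr do rewrite Y'S exprMn.
  by rewrite -mulr_sumr Y1 mulr1 cos2Dsin2.
- rewrite /c' c0 mulr1 -[RHS](mean_cst tau); congr mean.
  by apply/funext => x; rewrite !expr0 mulr1.
- move=> k; rewrite /c' doubleS.
  have := V0rec k.*2; have := crec k => h1 h2.
  rewrite [in RHS]mulrCA -h1 addSn -addnS addnC.
  transitivity ((k.*2 + n.+2)%:R * V 0 k.*2.+2 * c k.+1); first by ring.
  by rewrite h2 [(n.+1 + _)%N]addnC; ring.
move=> k u; pose a := u 0 ord0; pose v : 'rV[R]_n.+1 := \row_j u 0 (lift ord0 j).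
have uu : dotp u u = a ^+ 2 + dotp v v.
  rewrite /dotp big_ord_recl -expr2; congr (_ + _).
  by apply: eq_bigr => j _; rewrite mxE.
pose L t := \sum_i v 0 i * Y i t.
have bL : bounded_measurable L by apply: bm_sum => i; apply: bmZ.
have -> : (fun z => (\sum_i u 0 i * Y' i z) ^+ k.*2) = fun z =>
    \sum_(i < k.*2.+1) (a ^+ (k.*2 - i) *+ 'C(k.*2, i)) *
      ((cos z.1 ^+ (k.*2 - i) * sin z.1 ^+ i) * L z.2 ^+ i).
  apply/funext => z; rewrite big_ord_recl Y'0.
  have -> : \sum_(i < n.+1) u 0 (lift ord0 i) * Y' (lift ord0 i) z = sin z.1 * L z.2.
    by rewrite /L mulr_sumr; apply: eq_bigr => j _; rewrite Y'S mxE; ring.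
  rewrite exprDn; apply: eq_bigr => i _.
  by rewrite !exprMn -/a -mulrnAl; rewrite -[in LHS]mulr_natl -[in RHS]mulr_natl; ring.
have bterm (i : nat) : bounded_measurable (fun z : measurableTypeR R * T =>
      (cos z.1 ^+ (k.*2 - i) * sin z.1 ^+ i) * L z.2 ^+ i).
  apply: bmM; first exact: (bm_fst _ (bcs _ _)).
  exact: (bm_snd _ (bmX _ bL)).
rewrite mean_sum => [|i]; last by apply: bmZ; exact: bterm.
have mterm (i : nat) : mean (tau \x P)%E (fun z : measurableTypeR R * T =>
    (cos z.1 ^+ (k.*2 - i) * sin z.1 ^+ i) * L z.2 ^+ i) =
    V (k.*2 - i)%N i * mean P (fun t => L t ^+ i).
  rewrite mean_prod//=.
  rewrite mulrC -meanZ//; congr mean; apply/funext => x.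
  by rewrite meanZ 1?mulrC//; exact: bmX.
pose F i := (a ^+ (k.*2 - i) *+ 'C(k.*2, i)) * (V (k.*2 - i)%N i * mean P (fun t => L t ^+ i)).
transitivity (\sum_(i < k.*2.+1) F i).
  by apply: eq_bigr => i _; rewrite meanZ ?mterm.
(* For odd [i] the cosine has an odd exponent as well, so the term vanishes by [V0]. *)
rewrite sum_even_terms => [|i oi]; last first.
  have [ik|ki] := leqP i k.*2; last by rewrite /F bin_small// mulr0n mul0r.
  by rewrite /F V0 ?mul0r ?mulr0// oddB// odd_double oi.
rewrite uu exprDn mulr_sumr; apply: eq_bigr => l _.
have lk : (l <= k)%N by rewrite -ltnS.
have := binV (k - l)%N l; rewrite subnK// => bv.
rewrite /F cE -doubleB.
transitivity (a ^+ (k - l).*2 * dotp v v ^+ l * (V (k - l).*2 l.*2 * c l * 'C(k.*2, l.*2)%:R)).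
  by rewrite -mulr_natl; ring.
by rewrite bv -mul2n exprM -[in RHS]mulr_natl; ring.
Qed.

(** The law of the random unit vector is pushed forward to lines. In the moment formula [u] is a
    representative of [x], of length 1, so the value does not depend on [x]. *)
Lemma isotropic_exists n : exists (sigma : probability (RP R n) R) (c : nat -> R),
  forall k x, mean sigma (fun y => sqdot x y ^+ k) = c k.
Proof.
have [d [T [P [Y [c [bY Y1 _ _ cE]]]]]] := sphere_moments_exist n.
pose yv t : 'rV[R]_n.+1 := \row_i Y i t.
have yv1 t : dotp (yv t) (yv t) = 1.
  by rewrite -(Y1 t); apply: eq_bigr => i _; rewrite mxE expr2.
pose h t : RP R n := line_of (yv t).
have mh : measurable_fun setT h.
  apply: measurable_fun_RP => p.
  have -> : proj_entry p \o h = fun t => Y p.1 t * Y p.2 t.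
    by apply/funext => t; rewrite /h/= proj_entry_line_of// !mxE.
  by case: (bmM (bY p.1) (bY p.2)).
pose h' : {mfun T >-> RP R n} := HB.pack h (isMeasurableFun.Build _ _ _ _ _ mh).
exists (distribution P h'), c => k x.
rewrite mean_distribution; last exact: bm_sqdotrX.
have -> : (fun y => sqdot x y ^+ k) \o h' = fun t => (\sum_i rep x 0 i * Y i t) ^+ k.*2.
  apply/funext => t /=; rewrite /h -mul2n exprM; congr (_ ^+ k).
  rewrite /sqdot /rpdot -/(rep x) -/(rep (line_of (yv t))).
  have -> : \sum_i rep x 0 i * Y i t = dotp (rep x) (yv t).
    by apply: eq_bigr => i _; rewrite mxE.
  by case: (rep_line_of (yv1 t)) => ->//; rewrite dotpC dotpNl sqrrN dotpC.
by rewrite cE dotp_rep expr1n mulr1.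
Qed.

End sphere_moments.

(** * Rotations *)

Section line_reflections.
Context (R : realType) (m : nat).
Implicit Types (u v w : 'rV[R]_m) (S : 'M[R]_m).

(** For nonzero [u], the symmetry fixing the line of [u] and negating its orthogonal complement. Its
    determinant may be -1, so rotations are made from two of them. *)
Definition line_reflection u : 'M[R]_m :=
  (2 / dotp u u) *: (u^T *m u) - 1%:M.

Lemma mulmx_trmx_row u v w : u *m (v^T *m w) = dotp u v *: w.
Proof. by rewrite mulmxA [u *m v^T]mx11_scalar mul_scalar_mx -dotpE. Qed.

Lemma mulmx_line_reflection u v :
  v *m line_reflection u = (2 * dotp v u / dotp u u) *: u - v.
Proof.
rewrite /line_reflection mulmxBr -scalemxAr mulmx_trmx_row mulmx1 scalerA.
by rewrite mulrAC.
Qed.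

Lemma trmx_line_reflection u : (line_reflection u)^T = line_reflection u.
Proof.
by rewrite /line_reflection linearB/= linearZ/= trmx_mul trmxK trmx1.
Qed.

Lemma line_reflectionK u : dotp u u != 0 ->
  line_reflection u *m line_reflection u = 1%:M.
Proof.
move=> u0; apply/row_matrixP => i; rewrite row_mul mulmx_line_reflection.
set v := row i _.
have -> : v = (2 * dotp (delta_mx 0 i) u / dotp u u) *: u - delta_mx 0 i.
  by rewrite /v rowE mulmx_line_reflection.
rewrite dotpBl dotpZl row1.
set b := dotp (delta_mx 0 i) u.
rewrite opprB addrCA -scalerBl; set k := (X in X *: u).
have -> : k = 0 by rewrite /k; field.
by rewrite scale0r addr0.
Qed.

Lemma line_reflectionZ (a : R) u : a != 0 ->
  line_reflection (a *: u) = line_reflection u.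
Proof.
move=> a0; rewrite /line_reflection; congr (_ - _).
rewrite [(_ *: u)^T]linearZ/= -scalemxAl -scalemxAr !scalerA dotpZl dotpC dotpZl.
congr (_ *: _); have [->|u0] := eqVneq (dotp u u) 0.
  by rewrite !mulr0 invr0 mulr0 !mul0r.
by field; rewrite a0 u0.
Qed.

Lemma line_reflection_swap u v : dotp u u = dotp v v ->
  dotp (u + v) (u + v) != 0 -> u *m line_reflection (u + v) = v.
Proof.
move=> uv w0; rewrite mulmx_line_reflection.
have -> : 2 * dotp u (u + v) / dotp (u + v) (u + v) = 1.
  have -> : 2 * dotp u (u + v) = dotp (u + v) (u + v).
    rewrite dotpDD dotpC dotpDl -uv (dotpC v u); ring.
  by rewrite divff.
by rewrite scale1r addrC addKr.
Qed.

Lemma dotp_mulmx u v S : dotp (u *m S) v = dotp u (v *m S^T).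
Proof. by rewrite !dotpE trmx_mul trmxK mulmxA. Qed.

Lemma line_reflection_conj u S : S^T = S -> S *m S = 1%:M ->
  S *m line_reflection u *m S = line_reflection (u *m S).
Proof.
move=> St SS; rewrite /line_reflection mulmxBr mulmxBl mulmx1 SS.
rewrite dotp_mulmx St -[u *m S *m S]mulmxA SS mulmx1 -scalemxAr -scalemxAl.
by rewrite trmx_mul St !mulmxA.
Qed.

Lemma det_involution S : S *m S = 1%:M -> \det S * \det S = 1.
Proof. by move=> SS; rewrite -det_mulmx SS det1. Qed.

(** The reflection at [u] fixes [u], and the one at [u + v] sends [u] to [v]. The sign hypothesis
    keeps [u + v] nonzero. *)
Lemma rotation_transitive u v : dotp u u = 1 -> dotp v v = 1 -> 0 <= dotp u v ->
  exists2 Q, rotation Q & u *m Q = v.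
Proof.
move=> u1 v1 uv.
pose w := u + v; pose r := Num.sqrt (dotp w w).
have w2 : dotp w w = 2 + 2 * dotp u v by rewrite dotpDD u1 v1; ring.
have w0 : 0 < dotp w w by rewrite w2; lra.
have r0 : 0 < r by rewrite sqrtr_gt0.
have r2 : r ^+ 2 = dotp w w by rewrite sqr_sqrtr// ltW.
have uw : 0 <= dotp u w by rewrite dotpC dotpDl u1 (dotpC v u); lra.
pose z := r *: u + w.
have ru : dotp (r *: u) (r *: u) = dotp w w.
  by rewrite dotpZl dotpC dotpZl u1 mulr1 -expr2.
have z0 : dotp z z != 0.
  rewrite gt_eqF// dotpDD ru dotpZl.
  have : 0 <= r * dotp u w by rewrite mulr_ge0// ltW.
  lra.
(* As [r *: u] and [w] have equal length, the reflection at their sum [z] swaps them. The two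
   reflections are thus conjugate and have the same determinant, whose square is 1. *)
have wE : line_reflection w = line_reflection z *m line_reflection u *m line_reflection z.
  rewrite -(line_reflectionZ u (lt0r_neq0 r0)) line_reflection_conj.
  - by rewrite line_reflection_swap.
  - exact: trmx_line_reflection.
  - exact: line_reflectionK.
have Tu := @line_reflectionK u; rewrite u1 oner_eq0 in Tu; have {}Tu := Tu isT.
have Tw := line_reflectionK (lt0r_neq0 w0).
exists (line_reflection u *m line_reflection w).
  split.
    rewrite trmx_mul !trmx_line_reflection mulmxA -(mulmxA (line_reflection u)).
    by rewrite Tw mulmx1.
  rewrite det_mulmx wE !det_mulmx.
  have := det_involution Tu; have := det_involution (line_reflectionK z0).
  set a := \det _; set b := \det _ => aa bb.
  have -> : b * (a * b * a) = (b * b) * (a * a) by ring.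
  by rewrite aa bb mulr1.
rewrite mulmxA [u *m line_reflection u]mulmx_line_reflection u1 divr1 mulr1.
have -> : 2 *: u - u = u by rewrite scaler_nat mulr2n addrK.
apply: line_reflection_swap; first by rewrite u1 v1.
exact: lt0r_neq0.
Qed.

End line_reflections.

(** * Rotations acting on lines and measures *)

Section rotation_invariance.
Context (R : realType) (n : nat).
Local Notation X := (RP R n).
Implicit Types (x y : X) (mu nu : probability X R) (Q : 'M[R]_n.+1).

Lemma dotp_rotation Q (u v : 'rV[R]_n.+1) : rotation Q ->
  dotp (u *m Q) (v *m Q) = dotp u v.
Proof.
by move=> [QQ _]; rewrite dotp_mulmx -mulmxA QQ mulmx1.
Qed.

Lemma sqdot_line_of (u v : 'rV[R]_n.+1) : dotp u u = 1 -> dotp v v = 1 ->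
  sqdot (line_of u) (line_of v) = dotp u v ^+ 2.
Proof.
move=> u1 v1; rewrite /sqdot /rpdot -/(rep _) -/(rep (line_of v)).
case: (rep_line_of u1) => ->; case: (rep_line_of v1) => ->;
  by rewrite ?dotpNl 1?dotpC ?dotpNl ?opprK ?sqrrN// dotpC.
Qed.

Lemma sqdot_rotate Q x y : rotation Q ->
  sqdot (rotate Q x) (rotate Q y) = sqdot x y.
Proof.
move=> rQ; rewrite /rotate sqdot_line_of; first 1 last.
- by rewrite dotp_rotation// dotp_rep.
- by rewrite dotp_rotation// dotp_rep.
by rewrite dotp_rotation.
Qed.

Lemma measurable_rotate Q : rotation Q -> measurable_fun setT (@rotate R n Q).
Proof.
move=> rQ; apply: measurable_fun_RP => p.
have -> : proj_entry p \o rotate Q = fun x =>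
    \sum_i \sum_j (Q i p.1 * Q j p.2) * proj_entry (i, j) x.
  apply/funext => x; rewrite /= /rotate proj_entry_line_of; last first.
    by rewrite dotp_rotation// dotp_rep.
  rewrite !mxE big_distrlr/=; apply: eq_bigr => i _; apply: eq_bigr => j _.
  by rewrite /proj_entry/rep/=; ring.
have [] // : bounded_measurable (fun x : X =>
    \sum_i \sum_j (Q i p.1 * Q j p.2) * proj_entry (i, j) x).
by apply: bm_sum => i; apply: bm_sum => j; apply: bmZ; exact: bm_proj_entry.
Qed.

Lemma rotate_transitive x y : exists2 Q, rotation Q & rotate Q x = y.
Proof.
have [xy|xy] := leP 0 (dotp (rep x) (rep y)).
  have [Q rQ xQ] := rotation_transitive (dotp_rep x) (dotp_rep y) xy.
  by exists Q => //; rewrite /rotate -/(rep x) xQ line_of_rep.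
(* The opposite representative of [y] makes the scalar product nonnegative. *)
have Ny1 : dotp (- rep y) (- rep y) = 1.
  by rewrite dotpNl dotpC dotpNl opprK dotp_rep.
have [|Q rQ xQ] := rotation_transitive (dotp_rep x) Ny1.
  by rewrite dotpC dotpNl dotpC oppr_ge0 ltW.
exists Q => //; apply: sqdot_eq1.
rewrite -[y]line_of_rep /rotate -/(rep x) xQ.
by rewrite sqdot_line_of ?dotp_rep// dotpNl dotp_rep sqrrN expr1n.
Qed.

Lemma mean_rotate nu Q (f : X -> R) : rotation_invariant nu -> rotation Q ->
  bounded_measurable f -> mean nu (f \o rotate Q) = mean nu f.
Proof.
move=> nuinv rQ bf.
pose h : {mfun X >-> X} := HB.pack (@rotate R n Q)
  (isMeasurableFun.Build _ _ _ _ _ (measurable_rotate rQ)).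
rewrite -[LHS](@mean_distribution _ _ _ _ _ h)// /mean /Rintegral; congr fine.
by apply: eq_measure_integral => A mA _; exact: nuinv.
Qed.

Section isotropic.
Variables (sigma : probability X R) (c : nat -> R).
Hypothesis sigmac : forall k x, mean sigma (fun y => sqdot x y ^+ k) = c k.

(** The image of [sigma] under a rotation has the same energies, so [isotropic_unique] applies. *)
Lemma isotropic_rotation_invariant : rotation_invariant sigma.
Proof.
move=> Q rQ A mA.
pose h : {mfun X >-> X} := HB.pack (@rotate R n Q)
  (isMeasurableFun.Build _ _ _ _ _ (measurable_rotate rQ)).
apply: (isotropic_unique sigmac (mu := distribution sigma h)) => // k.
rewrite /double_mean mean_distribution; last first.
  exact: (bm_mean sigma (distribution sigma h) (@bm_sqdotX R n k)).
rewrite -[RHS](double_mean_isotropicr sigmac sigma k) /double_mean; congr mean.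
apply/funext => x /=; rewrite mean_distribution; last exact: bm_sqdotrX.
by congr mean; apply/funext => y /=; rewrite sqdot_rotate.
Qed.

(** By transitivity [nu] has constant potentials [c'] too. The mixed energy of [nu] and [sigma],
    computed in either order, gives [c' = c]. *)
Lemma rotation_invariant_unique nu : rotation_invariant nu -> same_measure nu sigma.
Proof.
move=> nuinv.
have nuc k x : mean nu (fun y => sqdot x y ^+ k) = mean nu (fun y => sqdot (point : X) y ^+ k).
  have [Q rQ <-] := rotate_transitive point x.
  rewrite -(mean_rotate nuinv rQ); last exact: bm_sqdotrX.
  by congr mean; apply/funext => y /=; rewrite sqdot_rotate.
pose c' k := mean nu (fun y => sqdot (point : X) y ^+ k).
have cc' k : c' k = c k.
  rewrite -(double_mean_isotropicr sigmac nu k).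
  transitivity (double_mean sigma nu (fun z => sqdot z.1 z.2 ^+ k)).
    by rewrite (double_mean_isotropicr nuc sigma k).
  rewrite !double_mean_sqdotX.
  by apply: eq_bigr => J _; rewrite mulrC.
apply: (isotropic_unique sigmac) => k.
by rewrite (double_mean_isotropicr nuc nu k); exact: cc'.
Qed.

End isotropic.
End rotation_invariance.

(** * Minimizers and their supports *)

Section minimizers.
Context (R : realType) (n : nat).
Local Notation X := (RP R n).
Implicit Types (x y : X) (mu nu : probability X R) (H : X * X -> R).

Lemma double_mean_density mu nu (g : X -> R) H :
  bounded_measurable g -> bounded_measurable H ->
  (forall f, bounded_measurable f -> mean nu f = mean mu (fun x => g x * f x)) ->
  double_mean nu nu H = double_mean mu mu (fun z => g z.1 * (g z.2 * H z)).
Proof.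
move=> bg bH nuE; rewrite /double_mean nuE; last exact: (bm_mean nu nu).
congr mean; apply/funext => x /=; rewrite nuE; last exact: bm_pair1.
rewrite meanZ//; apply: bmM => //; exact: bm_pair1.
Qed.

(* The perturbations (1 + t phi) mu and (1 - t phi) mu are probability measures
   for small t, and the sum of their energies is 2 I(mu) + 2 t^2 I(phi mu). *)
Lemma minimizer_psd (K : X -> X -> R) mu (phi : X -> R) :
  bounded_measurable (fun z : X * X => K z.1 z.2) -> energy_minimizer K mu ->
  bounded_measurable phi -> mean mu phi = 0 ->
  0 <= double_mean mu mu (fun z => phi z.1 * (phi z.2 * K z.1 z.2)).
Proof.
move=> bK minK bphi phi0; have [_ [M0 phiM0]] := bphi.
pose M := `|M0| + 1.
have M1 : 0 < M by rewrite ltr_wpDl.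
have phiM x : `|phi x| <= M.
  by rewrite (le_trans (phiM0 x))// /M (le_trans (ler_norm _))// lerDl.
(* This [t] keeps both perturbed densities nonnegative; [b] below selects the sign. *)
pose t := M^-1; have t0 : 0 < t by rewrite invr_gt0.
set H := (fun z : X * X => K z.1 z.2) in bK *.
have b1 (b : bool) : bounded_measurable (fun x => 1 + (-1) ^+ b * t * phi x).
  by apply: bmD; [exact: bm_cst|exact: bmZ].
have perturb (b : bool) : double_mean mu mu H <=
    double_mean mu mu (fun z => (1 + (-1) ^+ b * t * phi z.1) *
       ((1 + (-1) ^+ b * t * phi z.2) * H z)).
  have [||nu nuE] := @mean_density _ _ _ mu _ (b1 b).
  - move=> x; have : `|(-1) ^+ b * t * phi x| <= 1.
      rewrite !normrM normr_sign mul1r gtr0_norm// /t mulrC.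
      by rewrite ler_pdivrMr// mul1r.
    by rewrite ler_norml => /andP[]; lra.
  - by rewrite meanD ?meanZ ?phi0 ?mulr0 ?mean_cst ?addr0//; [exact: bm_cst|exact: bmZ].
  rewrite -(double_mean_density (b1 b) bK nuE).
  by have := minK nu; rewrite !energyE// lee_fin.
have h0 := perturb false; have h1 := perturb true.
have bZ (b : bool) : bounded_measurable (fun z : X * X =>
    (1 + (-1) ^+ b * t * phi z.1) * ((1 + (-1) ^+ b * t * phi z.2) * H z)).
  by apply: bmM; [exact: (bm_fst _ (b1 b))|apply: bmM => //; exact: (bm_snd _ (b1 b))].
have bphi2 : bounded_measurable (fun z : X * X => phi z.1 * (phi z.2 * H z)).
  by apply: bmM; [exact: (bm_fst _ bphi)|apply: bmM => //; exact: (bm_snd _ bphi)].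
have : double_mean mu mu (fun z => 2 * H z + 2 * t ^+ 2 * (phi z.1 * (phi z.2 * H z))) =
  double_mean mu mu (fun z => (1 + (-1) ^+ false * t * phi z.1) *
       ((1 + (-1) ^+ false * t * phi z.2) * H z)) +
  double_mean mu mu (fun z => (1 + (-1) ^+ true * t * phi z.1) *
       ((1 + (-1) ^+ true * t * phi z.2) * H z)).
  rewrite -double_meanD//; congr double_mean; apply/funext => z.
  by rewrite /= expr0 expr1; ring.
rewrite double_meanD ?double_meanZ//; [|exact: bmZ..].
set Q := double_mean mu mu (fun z => phi z.1 * _).
move: h0 h1; set E := double_mean mu mu H; set E0 := double_mean mu mu _; set E1 := double_mean mu mu _.
move=> h0 h1 QE.
have : 0 <= 2 * t ^+ 2 * Q by lra.
by rewrite pmulr_rge0// mulr_gt0// exprn_gt0.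
Qed.

Lemma continuous_kernel_caps H (e : R) : continuous H -> 0 < e ->
  exists2 r : R, 0 < r & forall x y x' y', cap x r x' -> cap y r y' ->
    `|H (x, y) - H (x', y')| < e.
Proof.
move=> cH e0.
have cTT : compact [set: X * X].
  by rewrite -setXTT; apply: compact_setX; exact: RP_compact.
pose D (z : (X * X) * (X * X)) : R :=
  (1 - sqdot z.1.1 z.2.1) + (1 - sqdot z.1.2 z.2.2).
have cs (p1 p2 : (X * X) * (X * X) -> X) : continuous p1 -> continuous p2 ->
    continuous (fun z => 1 - sqdot (p1 z) (p2 z)).
  move=> c1 c2 z.
  have cs : {for z, continuous (fun z => sqdot (p1 z) (p2 z))}.
    apply: (@cvg_comp _ _ _ (fun z => (p1 z, p2 z)) (fun z : X * X => sqdot z.1 z.2) _ _ _ _ (@sqdot_continuous R n (p1 z, p2 z))).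
    exact: (cvg_pair (c1 z) (c2 z)).
  exact: (continuousB (@cst_continuous _ R 1 z) cs).
have cD : continuous D.
  have c11 : continuous (fun z : (X * X) * (X * X) => z.1.1).
    by move=> z; exact: (cvg_comp _ _ (@cvg_fst _ _ _ _ _) (@cvg_fst _ _ _ _ _)).
  have c12 : continuous (fun z : (X * X) * (X * X) => z.1.2).
    by move=> z; exact: (cvg_comp _ _ (@cvg_fst _ _ _ _ _) (@cvg_snd _ _ _ _ _)).
  have c21 : continuous (fun z : (X * X) * (X * X) => z.2.1).
    by move=> z; exact: (cvg_comp _ _ (@cvg_snd _ _ _ _ _) (@cvg_fst _ _ _ _ _)).
  have c22 : continuous (fun z : (X * X) * (X * X) => z.2.2).
    by move=> z; exact: (cvg_comp _ _ (@cvg_snd _ _ _ _ _) (@cvg_snd _ _ _ _ _)).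
  by move=> z; exact: (continuousD (cs _ _ c11 c21 z) (cs _ _ c12 c22 z)).
have D0 z w : z <> w -> 0 < D (z, w).
  case: z w => [x y] [x' y'] zw; rewrite /D/=.
  have := sqdot_le1 x x'; have := sqdot_le1 y y'.
  have [xx|xx] := pselect (x = x').
    have /sqdot_lt1 : y <> y' by move=> yy; apply: zw; rewrite xx yy.
    lra.
  by have := sqdot_lt1 xx; lra.
have [r r0 Hr] := compact_modulus cTT cH cD D0 e0.
exists (r / 2); first by rewrite divr_gt0.
move=> x y x' y'; rewrite /cap/= => xx yy; apply: Hr; rewrite /D/=; lra.
Qed.

Lemma msupport_cap mu x r : msupport mu x -> 0 < r -> 0 < mean mu \1_(cap x r).
Proof.
move=> sx r0; rewrite -lte_fin mean_indic; last exact: cap_measurable.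
by apply: sx; [exact: cap_open|exact: cap_center].
Qed.

(** Point masses are approximated by normalized indicators of small caps, which have positive mass
    around support points, and [minimizer_psd] is applied to their combination. *)
Lemma minimizer_cpd (K : X -> X -> R) mu m (a : 'I_m -> R) (x_ : 'I_m -> X) :
  continuous (fun z : X * X => K z.1 z.2) ->
  bounded_measurable (fun z : X * X => K z.1 z.2) -> energy_minimizer K mu ->
  \sum_i a i = 0 -> (forall i, msupport mu (x_ i)) ->
  0 <= \sum_i \sum_j a i * a j * K (x_ i) (x_ j).
Proof.
move=> cK bK minK a0 sx; set H := (fun z : X * X => K z.1 z.2) in cK bK *.
(* If the form had a negative value [S], an oscillation of the kernel below [- S / A] would change
   it by less than [- S]; the extra 1 makes this strict. *)
pose A := \sum_i \sum_j `|a i * a j| + 1.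
have A0 : 0 < A by rewrite ltr_wpDl// sumr_ge0// => i _; rewrite sumr_ge0.
rewrite leNgt; apply/negP => S0.
set S := \sum_i _ in S0.
have e0 : 0 < - S / A by rewrite divr_gt0// oppr_gt0.
have [r r0 Hr] := continuous_kernel_caps cK e0.
pose f i x : R := \1_(cap (x_ i) r) x.
have bf i : bounded_measurable (f i) by exact: bm_cap.
pose w i := mean mu (f i).
have w0 i : 0 < w i by apply: msupport_cap.
pose phi x := \sum_i a i / w i * f i x.
have bphi : bounded_measurable phi by apply: bm_sum => i; apply: bmZ.
have phi0 : mean mu phi = 0.
  rewrite mean_sum => [|i]; last exact: bmZ.
  rewrite -[RHS]a0; apply: eq_bigr => i _; rewrite meanZ// -/(w i).
  by rewrite divfK// gt_eqF.
have := minimizer_psd bK minK bphi phi0; rewrite leNgt => /negP; apply.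
pose k i j := (a i / w i) * (a j / w j).
pose k' i j := `|a i * a j| / (w i * w j).
pose G (z : X * X) := \sum_i \sum_j
   (k i j * H (x_ i, x_ j) + k' i j * (- S / A)) * (f i z.1 * f j z.2).
have bff i j : bounded_measurable (fun z : X * X => f i z.1 * f j z.2).
  by apply: bmM; [exact: (bm_fst _ (bf i))|exact: (bm_snd _ (bf j))].
have bG : bounded_measurable G.
  by apply: bm_sum => i; apply: bm_sum => j; exact: bmZ.
have le1 : double_mean mu mu (fun z => phi z.1 * (phi z.2 * H z)) <= double_mean mu mu G.
  apply: double_mean_le => // [|z].
    by apply: bmM; [exact: (bm_fst _ bphi)|apply: bmM => //; exact: (bm_snd _ bphi)].
  rewrite mulrA /phi big_distrlr/= mulr_suml; apply: ler_sum => i _.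
  rewrite mulr_suml; apply: ler_sum => j _.
  have -> : a i / w i * f i z.1 * (a j / w j * f j z.2) * H z =
     k i j * H z * (f i z.1 * f j z.2) by rewrite /k; ring.
  rewrite /f !indicE; case: (boolP (z.1 \in _)) => [|_]; last by rewrite !mul0r !mulr0.
  rewrite inE => zi; case: (boolP (z.2 \in _)) => [|_]; last by rewrite !mulr0.
  rewrite inE => zj; rewrite !mulr1 -lerBlDl -mulrBr.
  apply: le_trans (ler_norm _) _; rewrite normrM distrC.
  have -> : `|k i j| = k' i j.
    rewrite /k /k' mulrACA -invfM normrM; congr (_ * _).
    by rewrite ger0_norm// invr_ge0 mulr_ge0// ltW.
  rewrite ler_wpM2l ?divr_ge0 ?mulr_ge0// ?(ltW (w0 _))//.
  by rewrite [z]surjective_pairing ltW// Hr.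
apply: le_lt_trans le1 _.
rewrite double_mean_sum => [|i]; last by apply: bm_sum => j; exact: bmZ.
have -> : \sum_i double_mean mu mu (fun z => \sum_j
   (k i j * H (x_ i, x_ j) + k' i j * (- S / A)) * (f i z.1 * f j z.2)) =
   S + (- S / A) * \sum_i \sum_j `|a i * a j|.
  rewrite mulr_sumr -big_split/=; apply: eq_bigr => i _.
  rewrite double_mean_sum => [|j]; last exact: bmZ.
  rewrite mulr_sumr -big_split/=; apply: eq_bigr => j _.
  rewrite double_meanZ//.
  have -> : double_mean mu mu (fun z => f i z.1 * f j z.2) = w i * w j.
    rewrite /double_mean/= [RHS]mulrC -meanZ//; congr mean; apply/funext => x.
    by rewrite meanZ// mulrC.
  rewrite /k /k' /H/=; field.
  by rewrite !gt_eqF.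
rewrite -subr_gt0.
have -> : 0 - (S + - S / A * \sum_i \sum_j `|a i * a j|) = - S / A.
  rewrite [X in - S / A * X](_ : _ = A - 1); last by rewrite /A addrK.
  by field; rewrite gt_eqF.
exact: e0.
Qed.

End minimizers.

(** * Estimates of the energy defect *)

Section energy_defect.
Context (R : realType) (N : nat).
Hypothesis N_ge3 : (3 <= N)%N.
Implicit Types a b w : R.

(* the difference B_q(x, x) - B_q(x, y), for q = 2 N and w = 1 - (x . y)^2 *)
Definition energy_defect w : R :=
  1 - expR (- w) - N%:R^-1 * (1 - (1 - w) ^+ N).

Let N0 : 0 < N%:R :> R.
Proof. by rewrite ltr0n (leq_trans _ N_ge3). Qed.

Lemma onem_exp_ub k w : 0 <= w <= 1 ->
  (1 - w) ^+ k <= 1 - k%:R * w + (k%:R * w) ^+ 2.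
Proof.
move=> /andP[w0 w1]; elim: k => [|k ih]; first by rewrite expr0 mul0r expr2 mul0r; lra.
rewrite exprS; apply: (@le_trans _ _ ((1 - w) * (1 - k%:R * w + (k%:R * w) ^+ 2))).
  by rewrite ler_wpM2l// subr_ge0.
rewrite -natr1; have k0 : 0 <= k%:R :> R by [].
set t := k%:R in k0 *; rewrite -subr_ge0.
have -> : 1 - (t + 1) * w + ((t + 1) * w) ^+ 2 - (1 - w) * (1 - t * w + (t * w) ^+ 2) =
   (t + 1) * w ^+ 2 + t ^+ 2 * w ^+ 3 by ring.
by rewrite addr_ge0// mulr_ge0 ?exprn_ge0// addr_ge0.
Qed.

(** The terms linear in [w] cancel, and [w] is itself quadratic in the distance of the lines. *)
Lemma energy_defect_ub w : 0 <= w <= 1 -> energy_defect w <= N%:R * w ^+ 2.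
Proof.
move=> w01; have /andP[w0 w1] := w01.
have h1 := expR_ge1Dx (- w).
have h2 : N%:R^-1 * (N%:R * w - (N%:R * w) ^+ 2) <= N%:R^-1 * (1 - (1 - w) ^+ N).
  by rewrite ler_pM2l ?invr_gt0//; have := onem_exp_ub N w01; lra.
have e : N%:R^-1 * (N%:R * w - (N%:R * w) ^+ 2) = w - N%:R * w ^+ 2.
  by field; rewrite gt_eqF.
by rewrite e in h2; rewrite /energy_defect; lra.
Qed.

Lemma expr_diff_ub k a b : 0 <= b -> b <= a ->
  a ^+ k.+1 - b ^+ k.+1 <= k.+1%:R * (a - b) * a ^+ k.
Proof.
move=> b0 ba; have a0 : 0 <= a by exact: le_trans ba.
elim: k => [|k ih]; first by rewrite !expr1 expr0; lra.
have h1 : a * (a ^+ k.+1 - b ^+ k.+1) <= a * (k.+1%:R * (a - b) * a ^+ k).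
  by rewrite ler_wpM2l.
have h2 : (a - b) * b ^+ k.+1 <= (a - b) * a ^+ k.+1.
  by rewrite ler_wpM2l ?subr_ge0// lerXn2r// nnegrE.
rewrite [a ^+ k.+2]exprS [b ^+ k.+2]exprS -[k.+2%:R]natr1.
have -> : (k.+1%:R + 1) * (a - b) * a ^+ k.+1 =
   a * (k.+1%:R * (a - b) * a ^+ k) + (a - b) * a ^+ k.+1 by rewrite exprS; ring.
by lra.
Qed.

(** The derivative exp(-w) - (1 - w)^(N-1) is at least (1 - w) - (1 - w)^2 because [N] is at least
    3; this is a discrete version of that bound. *)
Lemma energy_defect_lip a b : 0 <= a -> a <= b -> b <= 1 ->
  (b - a) * (a * (1 - a) - (b - a)) <= energy_defect b - energy_defect a.
Proof.
move=> a0 ab b1.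
have h1 : (1 - b) * (b - a) <= expR (- a) - expR (- b).
  have -> : expR (- a) - expR (- b) = expR (- b) * (expR (b - a) - 1).
    by rewrite mulrBr mulr1 -expRD addrA addNr add0r.
  apply: ler_pM; rewrite ?subr_ge0//.
    by rewrite -[X in X <= _]/(1 + - b) expR_ge1Dx.
  by rewrite lerBrDl expR_ge1Dx.
have h2 : N%:R^-1 * ((1 - a) ^+ N - (1 - b) ^+ N) <= (b - a) * (1 - a) ^+ 2.
  case: N N_ge3 N0 => // k k3 k0.
  rewrite ler_pdivrMl//.
  apply: le_trans (expr_diff_ub _ _ _) _; [lra|lra|].
  have -> : 1 - a - (1 - b) = b - a by ring.
  rewrite mulrA ler_wpM2l ?mulr_ge0 ?subr_ge0//.
  by apply: ler_wiXn2l => //; lra.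
rewrite /energy_defect.
have -> : 1 - expR (- b) - N%:R^-1 * (1 - (1 - b) ^+ N) -
    (1 - expR (- a) - N%:R^-1 * (1 - (1 - a) ^+ N)) =
  expR (- a) - expR (- b) - N%:R^-1 * ((1 - a) ^+ N - (1 - b) ^+ N) by ring.
have -> : (b - a) * (a * (1 - a) - (b - a)) = (1 - b) * (b - a) - (b - a) * (1 - a) ^+ 2 by ring.
by lra.
Qed.

End energy_defect.

(** * Accumulation and triples of support points *)

Section finite_support.
Context (R : realType) (n : nat).
Local Notation X := (RP R n).
Implicit Types (x y p : X) (mu : probability X R).

Lemma infinite_accumulation (A : set X) : ~ finite_set A ->
  exists p, forall r : R, 0 < r -> exists y, [/\ A y, y <> p & cap p r y].
Proof.
move=> Ainf; apply: contrapT => /forallNP noacc; apply: Ainf.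
have /choice[r rP] : forall p, exists r : R, 0 < r /\ (A `&` cap p r `<=` [set p]).
  move=> p; have /existsNP[r /not_implyP[r0 nor]] := noacc p.
  exists r; split=> // y [Ay py]; apply: contrapT => yp.
  by apply: nor; exists y.
have := @RP_compact R n; rewrite compact_cover.
move=> /(_ _ setT (fun x => cap x (r x))) [| y _ |D _ Dcover].
- by move=> x _; exact: cap_open.
- by exists y => //; apply: cap_center; have [] := rP y.
apply: sub_finite_set (finite_fset D) => y Ay.
have [x xD xy] := Dcover y I.
by have [_ /(_ y (conj Ay xy)) ->] := rP x.
Qed.

Lemma msupport_closed mu p :
  (forall r : R, 0 < r -> exists y, [/\ msupport mu y, y <> p & cap p r y]) ->
  msupport mu p.
Proof.
move=> acc U oU Up; have [r r0 capU] := open_cap oU Up.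
by have [y [sy _ py]] := acc r r0; apply: sy => //; exact: capU.
Qed.

(** The projection matrix, flattened to a row so that [dotp] and compactness of boxes apply. *)
Definition proj_embedding x : 'rV[R]_#|{: 'I_n.+1 * 'I_n.+1}| :=
  \row_k proj_entry (enum_val k) x.

Lemma dotp_proj_embedding x y :
  dotp (proj_embedding x) (proj_embedding y) = sqdot x y.
Proof.
rewrite /dotp sqdotE [RHS](reindex _ (onW_bij _ (enum_val_bij _)))/=.
by apply: eq_bigr => k _; rewrite !mxE.
Qed.

Section three_points.
Variables (N : nat) (K : X -> X -> R) (mu : probability X R).
Hypothesis N_ge3 : (3 <= N)%N.
Hypothesis K_E : forall x y,
  K x y = expR (sqdot x y - 1) - N%:R^-1 * sqdot x y ^+ N.
Hypothesis minK : energy_minimizer K mu.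

Let h := @energy_defect R N.

Let K_defect x y : K x y = 1 - N%:R^-1 - h (1 - sqdot x y).
Proof.
by rewrite K_E /h /energy_defect [1 - (1 - _)]subKr [- (1 - _)]opprB; ring.
Qed.

Let K_continuous : continuous (fun z : X * X => K z.1 z.2).
Proof.
have -> : (fun z : X * X => K z.1 z.2) =
    fun z => expR (sqdot z.1 z.2 - 1) - N%:R^-1 * sqdot z.1 z.2 ^+ N.
  by apply/funext => z; rewrite K_E.
move=> z.
have c1 := continuousB (@sqdot_continuous R n z) (@cst_continuous _ R 1 z).
have c2 := cvg_comp _ _ c1 (@continuous_expR R (sqdot z.1 z.2 - 1)).
have cN := @continuous_exp R (X * X)%type _ N (@sqdot_continuous R n) z.
have c3 := continuousM (@cst_continuous _ R N%:R^-1 z) cN.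
exact: (continuousB c2 c3).
Qed.

Let bK : bounded_measurable (fun z : X * X => K z.1 z.2).
Proof.
have -> : (fun z : X * X => K z.1 z.2) =
    fun z => expsq z - N%:R^-1 * sqdot z.1 z.2 ^+ N.
  by apply/funext => z; rewrite K_E.
by apply: bmB; [exact: bm_expsq|apply: bmZ; exact: bm_sqdotX].
Qed.

Let hxy x y := h (1 - sqdot x y).

(** This is half the form of [minimizer_cpd] with weights a, -(a + b), b at x, y, p; the weights sum
    to 0, so the constant diagonal value of [K] drops out. *)
Lemma three_points x y p a b : msupport mu x -> msupport mu y -> msupport mu p ->
  0 <= a ^+ 2 * hxy x y + a * b * (hxy x y + hxy y p - hxy x p) + b ^+ 2 * hxy y p.
Proof.
move=> sx sy sp.
pose c (i : 'I_3) : R := nth 0 [:: a; - (a + b); b] i.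
pose q (i : 'I_3) : X := nth point [:: x; y; p] i.
have c0 : \sum_i c i = 0 by rewrite !big_ord_recl big_ord0 /c/=; ring.
have sq i : msupport mu (q i) by case: i => [[|[|[|?]]] ?].
have := minimizer_cpd K_continuous bK minK c0 sq.
rewrite !big_ord_recl !big_ord0 /c /q/= !K_defect -!/(hxy _ _).
have hC u v : hxy u v = hxy v u by rewrite /hxy sqdotC.
have h0 u : hxy u u = 0.
  by rewrite /hxy sqdotxx subrr /h /energy_defect oppr0 expR0 addr0 expr1n; ring.
rewrite !h0 (hC y x) (hC p x) (hC p y).
move=> H; have {}H : 0 <= 2 * (a ^+ 2 * hxy x y + a * b * (hxy x y + hxy y p - hxy x p) + b ^+ 2 * hxy y p).
  by apply: le_trans H _; rewrite le_eqVlt; apply/orP; left; apply/eqP; ring.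
by rewrite pmulr_rge0 in H.
Qed.

Let w01 x y : 0 <= 1 - sqdot x y <= 1.
Proof. by rewrite subr_ge0 sqdot_le1/= lerBlDr lerDl sqdot_ge0. Qed.

(* Conditional positive definiteness on three support points turns the quartic
   decay of the defect at [y = p] into a quadratic bound. *)
Lemma support_defect_diff x y p : msupport mu x -> msupport mu y -> msupport mu p ->
  `|hxy x y - hxy x p| <= 3 * N%:R * (1 - sqdot y p).
Proof.
move=> sx sy sp.
have [->|yp] := pselect (y = p); first by rewrite sqdotxx !subrr normr0 mulr0.
set w := 1 - sqdot y p.
have w0 : 0 < w by rewrite subr_gt0 sqdot_lt1.
have w1 : w <= 1 by have /andP[] := w01 y p.
have hyp : hxy y p <= N%:R * w ^+ 2 by apply: energy_defect_ub => //; exact: w01.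
have hyp0 : 0 <= hxy y p.
  by have := three_points 0 1 sx sy sp; rewrite expr0n/= !mul0r !add0r expr1n mul1r.
have A1 : hxy x y <= N%:R.
  apply: le_trans (energy_defect_ub N_ge3 (w01 x y)) _.
  have /andP[? ?] := w01 x y.
  by rewrite ler_piMr// exprn_ile1.
(* The weight [w] balances [w ^+ 2 * A] against [C], of order [w ^+ 2]; dividing by [w] leaves a
   bound linear in [w], and the two signs give both directions. *)
have up := three_points w 1 sx sy sp; have dn := three_points w (-1) sx sy sp.
move: up dn; rewrite !mulr1 expr1n mul1r sqrrN expr1n mul1r mulrN1.
set A := hxy x y in A1 *; set C := hxy y p in hyp hyp0 *; set B := hxy x p => up dn.
have wA : w ^+ 2 * A <= w * (N%:R * w).
  by rewrite mulrCA -expr2 mulrC ler_wpM2r// sqr_ge0.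
have wC : C <= w * (N%:R * w) by rewrite mulrCA -expr2.
have up' : w * (B - A - C) <= w * (2 * N%:R * w).
  have -> : w * (2 * N%:R * w) = w * (N%:R * w) + w * (N%:R * w) by ring.
  by lra.
have dn' : w * (A + C - B) <= w * (2 * N%:R * w).
  have -> : w * (2 * N%:R * w) = w * (N%:R * w) + w * (N%:R * w) by ring.
  by lra.
rewrite ler_pM2l// in up'; rewrite ler_pM2l// in dn'.
have CN : C <= N%:R * w.
  by apply: le_trans hyp _; rewrite ler_wpM2l// expr2 ler_piMr// ltW.
have Nw : 0 <= N%:R * w by rewrite mulr_ge0// ltW.
by rewrite ler_norml; apply/andP; split; lra.
Qed.

End three_points.
End finite_support.

Section minimizer_support.
Context (R : realType) (n : nat).
Local Notation X := (RP R n).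

(* If the support of a minimizer had an accumulation point p, the secant
   directions at p (in the embedding of lines as projections) of nearby support
   points would cluster at a unit vector orthogonal to all of them. *)
Lemma minimizer_finite_support (N : nat) (K : X -> X -> R) (mu : probability X R) :
  (3 <= N)%N ->
  (forall x y, K x y = expR (sqdot x y - 1) - N%:R^-1 * sqdot x y ^+ N) ->
  energy_minimizer K mu -> finite_set (msupport mu).
Proof.
move=> N3 KE minK; apply: contrapT => /infinite_accumulation[p acc].
have sp := msupport_closed acc.
have /choice[y yP] : forall k : nat, exists y : X,
    [/\ msupport mu y, y <> p & cap p k.+1%:R^-1 y].
  by move=> k; apply: acc; rewrite invr_gt0.
pose w x : R := 1 - sqdot x p.
have w_gt0 x : x <> p -> 0 < w x by move=> xp; rewrite subr_gt0 sqdot_lt1.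
have wy k : 0 < w (y k) by have [_ /w_gt0] := yP k.
have w_cvg : w (y k) @[k --> \oo] --> 0.
  apply: (squeeze_cvgr _ (cvg_cst 0) (@cvg_harmonic R)).
  apply: nearW => k; rewrite (ltW (wy k))/=.
  by have [_ _] := yP k; rewrite /cap/= /w sqdotC => /ltW.
pose v x := proj_embedding x - proj_embedding p.
have vv x : dotp (v x) (v x) = 2 * w x.
  by rewrite dotpBB !dotp_proj_embedding !sqdotxx /w; ring.
have vxy x z : dotp (v x) (v z) = w x + w z - (1 - sqdot x z).
  rewrite dotpBl ![dotp _ (v z)]dotpC !dotpBl !dotp_proj_embedding sqdotxx /w.
  by rewrite (sqdotC z x) (sqdotC p x); ring.
pose r k : R := Num.sqrt (2 * w (y k)).
have r2 k : r k ^+ 2 = 2 * w (y k) by rewrite sqr_sqrtr// mulr_ge0// ltW.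
have r0 k : 0 < r k by rewrite sqrtr_gt0 mulr_gt0.
have r_cvg : r k @[k --> \oo] --> 0.
  have : 2 * w (y k) @[k --> \oo] --> (2 * 0 : R) by apply: cvgM; [exact: cvg_cst|].
  rewrite mulr0 => /cvg_comp/(_ (@sqrt_continuous R 0)).
  by rewrite sqrtr0.
pose u k := (r k)^-1 *: v (y k).
have u1 k : dotp (u k) (u k) = 1.
  rewrite dotpZl dotpC dotpZl vv -r2; field.
  by rewrite gt_eqF.
have orth x : msupport mu x -> x <> p -> w x <= 1 / 4 ->
    dotp (v x) (u k) @[k --> \oo] --> 0.
  move=> sx xp x4; have W0 := w_gt0 x xp; set W := w x in x4 W0.
  pose C := 1 + 12 * N%:R / W.
  have C0 : 0 < C by rewrite ltr_pwDl// divr_ge0 ?mulr_ge0// ltW.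
  have W8 : 0 < W / 8 by rewrite divr_gt0.
  have sc : continuous (fun z : X => sqdot x z) by exact: sqdotr_continuous.
  have [del del0 delP] := continuous_cap sc W8.
  apply/cvgrPdist_lt => e e0.
  have Ce : 0 < e / C by rewrite divr_gt0.
  have /cvgrPdist_lt/(_ _ Ce) near_r := r_cvg.
  have /cvgrPdist_lt/(_ _ del0) near_w := w_cvg.
  near=> k.
  have rk : r k < e / C.
    have : `|0 - r k| < e / C by near: k; exact: near_r.
    by rewrite sub0r normrN gtr0_norm.
  have wk : w (y k) < del.
    have : `|0 - w (y k)| < del by near: k; exact: near_w.
    by rewrite sub0r normrN gtr0_norm.
  have := delP _ _ wk; set Z := 1 - sqdot x (y k) => dZ.
  have {}dZ : `|Z - W| < W / 8.
    by rewrite /Z /W /w opprD opprK addrACA subrr add0r addrC distrC.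
  have [syk _ _] := yP k.
  have := support_defect_diff N3 KE minK sx syk sp.
  rewrite -/(w x) -/W -/Z -/(w (y k)) => hd.
  (* With [W] at most 1/4 and [Z] within [W / 8] of it, the slope in [energy_defect_lip] is at least
     [W / 4]. *)
  have WZ : W / 4 * `|Z - W| <= 3 * N%:R * w (y k).
    apply: le_trans hd.
    have Z0 : 0 <= Z by rewrite subr_ge0 sqdot_le1.
    have Z1 : Z <= 1 by rewrite lerBlDr lerDl sqdot_ge0.
    move: dZ; case: (leP W Z) => [WZ|/ltW ZW].
      rewrite (@ger0_norm _ (Z - W)) ?subr_ge0// => dZ.
      apply: le_trans (ler_norm _); apply: le_trans (energy_defect_lip N3 (ltW W0) WZ Z1).
      rewrite mulrC ler_wpM2l ?subr_ge0//; nra.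
    rewrite (@ler0_norm _ (Z - W)) ?subr_le0// opprB => dZ; rewrite distrC.
    have W1 : W <= 1 by lra.
    apply: le_trans (ler_norm _); apply: le_trans (energy_defect_lip N3 Z0 ZW W1).
    rewrite mulrC ler_wpM2l ?subr_ge0//; nra.
  (* The product is of order [w (y k)], hence of order [r k ^+ 2], whereas [u k] divides only by
     [r k]. *)
  have dv : `|dotp (v x) (v (y k))| <= C * w (y k).
    rewrite vxy -/W -/Z (_ : W + w (y k) - Z = w (y k) - (Z - W)); last by ring.
    rewrite (le_trans (ler_normB _ _))// gtr0_norm// /C mulrDl mul1r lerD2l.
    rewrite -(@ler_pM2l _ (W / 4)) ?divr_gt0//; apply: le_trans WZ _.
    rewrite le_eqVlt; apply/orP; left; apply/eqP; field.
    by rewrite gt_eqF.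
  rewrite sub0r normrN dotpC dotpZl dotpC normrM gtr0_norm ?invr_gt0//.
  rewrite ltr_pdivrMl//; apply: le_lt_trans dv _.
  have -> : w (y k) = r k ^+ 2 / 2 by rewrite r2; field.
  rewrite ltr_pdivlMr// in rk.
  have -> : C * (r k ^+ 2 / 2) = r k * (r k * C / 2) by ring.
  rewrite ltr_pM2l//.
  have : 0 < r k * C by rewrite mulr_gt0.
  by lra.
(* The unit vectors [u k] lie in this box, so they have a cluster point [U]; the filter [G] below
   refines the sequence and converges to [U]. *)
have cbox : compact [set z : 'rV[R]_#|{: 'I_n.+1 * 'I_n.+1}| |
    forall i, z ord0 i \in `[(- 1 : R), 1]].
  apply: (@rV_compact _ _ (fun=> `[(- 1 : R), 1]%classic)) => i.
  exact: segment_compact.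
have PF : ProperFilter (u @ \oo) by exact: fmap_proper_filter.
have [|U [_]] := cbox (u @ \oo) PF.
  exists 0%N => // k _ i; rewrite in_itv/= -ler_norml.
  rewrite -(@ler_pXn2r _ 2)// ?nnegrE// expr1n real_normK ?num_real//.
  by rewrite -(u1 k) dotp_coord.
rewrite cluster_cvgE => -[G PG [GU uG]].
have lim (g : 'rV[R]_#|{: 'I_n.+1 * 'I_n.+1}| -> R) l :
    continuous g -> g (u k) @[k --> \oo] --> l -> g U = l.
  move=> cg gl; have gU : g @ G --> g U by apply: (cvg_comp _ _ GU); exact: cg.
  have gl' : g @ G --> l by move=> B /gl; exact: uG.
  exact: (cvg_unique _ gU gl').
have UU : dotp U U = 1.
  apply: (lim (fun z => dotp z z)); first exact: dotpp_continuous.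
  by under eq_fun do rewrite u1; exact: cvg_cst.
have xU x : msupport mu x -> x <> p -> w x <= 1 / 4 -> dotp (v x) U = 0.
  move=> sx xp x4; apply: (lim (dotp (v x))); first exact: dotp_continuous.
  exact: orth.
(* The [y k] are eventually admissible as [x] in [xU], so [U] is orthogonal to [u k] for all large
   [k]. *)
have UU0 : dotp U U = 0.
  apply: (lim (dotp U)); first exact: dotp_continuous.
  have q4 : 0 < 1 / 4 :> R by lra.
  have /cvgrPdist_lt/(_ _ q4) near_w := w_cvg.
  apply: cvg_near_cst; near=> k.
  have wk : w (y k) < 1 / 4.
    have : `|0 - w (y k)| < 1 / 4 by near: k; exact: near_w.
    by rewrite sub0r normrN gtr0_norm.
  have [syk ykp _] := yP k.
  by rewrite dotpC dotpZl xU ?mulr0// ltW.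
by move: UU; rewrite UU0 => /eqP; rewrite eq_sym oner_eq0.
Unshelve. all: by end_near. Qed.

End minimizer_support.

(** * Minimizers for the kernels B and B_q *)

Section minimizers_of_kernelBq.
Context (R : realType) (n : nat).
Local Notation X := (RP R n).
Implicit Types (mu nu : probability X R).

(** Small caps about the support points carry the whole mass, so one of them has mass at least 1/N;
    for two points in it [sqdot ^+ k] is at least 1/2. *)
Lemma finite_support_moment_lb mu N k :
  finite_set (msupport mu) -> (#|` fset_set (msupport mu)| <= N)%N ->
  1 <= 2 * N%:R ^+ 2 * double_mean mu mu (fun z => sqdot z.1 z.2 ^+ k).
Proof.
move=> fin cardN.
(* Two points of a cap of radius [r] satisfy [1 - sqdot < 4 * r], and Bernoulli's inequality bounds
   (1 - 4r)^k below by 1/2. *)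
pose r : R := (8 * k.+1%:R)^-1.
have k0 : 0 < k.+1%:R :> R by rewrite ltr0n.
have r0 : 0 < r by rewrite invr_gt0 mulr_gt0.
have kr : k.+1%:R * (4 * r) = 1 / 2 by rewrite /r; field; rewrite gt_eqF.
have r1 : 4 * r <= 1 / 2.
  by rewrite -kr ler_peMl ?ler1n// mulr_ge0// ltW.
have rk : 1 / 2 <= (1 - 4 * r) ^+ k.
  apply: le_trans (bernoulli_onem k _); last by apply/andP; split; lra.
  by move: kr; rewrite -natr1; nra.
(* Points outside the support have null neighbourhoods, so a finite subcover has its mass on caps
   around support points. *)
have /choice[V VP] : forall y, exists V : set X, [/\ open V, V y &
    mean mu \1_V = 0 \/ msupport mu y /\ V = cap y r].
  move=> y; have [sy|sy] := pselect (msupport mu y).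
    by exists (cap y r); split; [exact: cap_open|exact: cap_center|right].
  have /existsNP[V /not_implyP[oV /not_implyP[Vy V0]]] := sy.
  exists V; split => //; left; apply/eqP; rewrite -eqe mean_indic; last exact: RP_open_measurable.
  by rewrite eq_le measure_ge0 andbT leNgt; apply/negP.
have bV y : bounded_measurable (\1_(V y) : X -> R).
  by apply: bm_indic; apply: RP_open_measurable; have [] := VP y.
have := @RP_compact R n; rewrite compact_cover.
move=> /(_ _ setT V) [| y _ |D _ Dcover].
- by move=> y _; have [] := VP y.
- by exists y => //; have [] := VP y.
have V1 : 1 <= \sum_(y <- enum_fset D) mean mu \1_(V y).
  rewrite -mean_sum// -[X in X <= _](mean_cst mu).
  apply: mean_le => [| |z]; [exact: bm_cst|exact: bm_sum|].
  have [y yD yz] := Dcover z I.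
  rewrite (big_rem y)//= indicE mem_set//= lerDl.
  by apply: sumr_ge0 => x _; rewrite indicE.
pose S := fset_set (msupport mu).
have bcap x : bounded_measurable (\1_(cap x r) : X -> R) by exact: bm_cap.
have S1 : 1 <= \sum_(x <- enum_fset S) mean mu \1_(cap x r).
  apply: le_trans V1 _.
  rewrite (bigID (mem S))/= [X in _ + X]big1 ?addr0 => [|y yS]; last first.
    have [_ _ [//|[sy _]]] := VP y.
    by move: yS; rewrite in_fset_set// mem_set.
  apply: (@le_trans _ _ (\sum_(y <- enum_fset D | y \in S) mean mu \1_(cap y r))).
    apply: ler_sum => y _; have [_ _ [->|[_ ->]]] := VP y => //.
    by apply: mean_ge0 => z; rewrite indicE.
  rewrite -[leLHS]big_filter.
  have uf : uniq [seq y <- enum_fset D | y \in S] by rewrite filter_uniq// fset_uniq.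
  rewrite [leRHS](bigID (mem (enum_fset D)))/=.
  rewrite -[X in X <= _]addr0 lerD//; last first.
    by apply: sumr_ge0 => x _; apply: mean_ge0 => z; rewrite indicE.
  rewrite -[leRHS]big_filter le_eqVlt; apply/orP; left; apply/eqP.
  apply: perm_big; apply: uniq_perm => //; first by rewrite filter_uniq// fset_uniq.
  by move=> y; rewrite !mem_filter andbC.
have [x xw] : exists x, 1 <= N%:R * mean mu \1_(cap x r).
  apply: contrapT => /forallNP h; move: S1; apply/negP; rewrite -ltNge.
  have wlt x : N%:R * mean mu \1_(cap x r) < 1 by rewrite ltNge; apply/negP/h.
  have [->|N0] := eqVneq (enum_fset S) [::]; first by rewrite big_nil.
  have S0 : (0 < size (enum_fset S))%N by rewrite lt0n size_eq0.
  have NS0 : 0 < N%:R :> R by rewrite ltr0n (leq_trans S0).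
  have sN : (size (enum_fset S))%:R <= N%:R :> R by rewrite ler_nat.
  apply: (@lt_le_trans _ _ (\sum_(x <- enum_fset S) N%:R^-1)); last first.
    rewrite big_const_seq count_predT iter_addr_0 -[_ *+ _]mulr_natl.
    by rewrite -[_ * _]/(_ / _) ler_pdivrMr// mul1r.
  apply: ltr_sum => [|y _]; last by rewrite -(ltr_pM2l NS0) mulfV ?gt_eqF.
  by rewrite has_predT.
have ww : mean mu \1_(cap x r) ^+ 2 / 2 <= double_mean mu mu (fun z => sqdot z.1 z.2 ^+ k).
  have bcc : bounded_measurable (fun z : X * X => \1_(cap x r) z.1 * \1_(cap x r) z.2 : R).
    by apply: bmM; [exact: (bm_fst _ (bcap x))|exact: (bm_snd _ (bcap x))].
  have <- : double_mean mu mu (fun z => 2^-1 * (\1_(cap x r) z.1 * \1_(cap x r) z.2)) =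
      mean mu \1_(cap x r) ^+ 2 / 2.
    rewrite double_meanZ// mulrC; congr (_ / _).
    rewrite /double_mean/= expr2 -meanZ//; congr mean; apply/funext => y.
    by rewrite meanZ// mulrC.
  apply: double_mean_le => [| |z]; [exact: bmZ|exact: bm_sqdotX|].
  have sk0 : 0 <= sqdot z.1 z.2 ^+ k by rewrite exprn_ge0// sqdot_ge0.
  rewrite !indicE; case: (boolP (z.1 \in _)) => [|_]; last by rewrite mul0r mulr0.
  rewrite inE /cap/= => z1; case: (boolP (z.2 \in _)) => [|_]; last by rewrite !mulr0.
  rewrite inE /cap/= => z2; rewrite !mulr1.
  have := sqdot_triangle x z.1 z.2 => tri.
  apply: le_trans (_ : (1 - 4 * r) ^+ k <= _); first by lra.
  by apply: lerXn2r; rewrite ?nnegrE ?sqdot_ge0//; lra.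
set E := double_mean _ _ _ in ww *; set w := mean _ _ in xw ww.
have : 1 <= (N%:R * w) ^+ 2 by rewrite exprn_ege1.
move=> /le_trans; apply; rewrite exprMn.
have -> : 2 * N%:R ^+ 2 * E = N%:R ^+ 2 * (2 * E) by ring.
by rewrite ler_wpM2l ?exprn_ge0//; lra.
Qed.

Lemma kernelBqE q (x y : X) : ~~ odd q ->
  kernelBq q x y = expR (sqdot x y - 1) - q./2%:R^-1 * sqdot x y ^+ q./2.
Proof.
move=> oq; rewrite /kernelBq /kernelB -/(sqdot x y); congr (_ - _).
have {1 2}-> : q = q./2.*2 by rewrite -[LHS]odd_double_half (negbTE oq).
rewrite -mul2n exprM real_normK ?num_real// -/(sqdot x y) natrM; congr (_ * _).
(* At q = 0 both coefficients are 0, the inverse of 0 being 0. *)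
have [->|q0] := eqVneq q./2 0%N; first by rewrite mulr0 invr0 mulr0.
by field; rewrite pnatr_eq0.
Qed.

Lemma bm_kernelBq q : ~~ odd q -> bounded_measurable (fun z : X * X => kernelBq q z.1 z.2).
Proof.
move=> oq.
have -> : (fun z : X * X => kernelBq q z.1 z.2) =
    fun z => expsq z - q./2%:R^-1 * sqdot z.1 z.2 ^+ q./2.
  by apply/funext => z; rewrite kernelBqE.
by apply: bmB; [exact: bm_expsq|apply: bmZ; exact: bm_sqdotX].
Qed.

Lemma double_mean_kernelBq q mu : ~~ odd q ->
  double_mean mu mu (fun z => kernelBq q z.1 z.2) = double_mean mu mu (@expsq R n) -
    q./2%:R^-1 * double_mean mu mu (fun z => sqdot z.1 z.2 ^+ q./2).
Proof.
move=> oq; rewrite -double_meanZ; last exact: bm_sqdotX.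
rewrite -double_meanB; [|exact: bm_expsq|exact/bmZ/bm_sqdotX].
by congr double_mean; apply/funext => z; rewrite kernelBqE.
Qed.

Lemma double_mean_sqdotX01 mu nu k :
  0 <= double_mean mu nu (fun z => sqdot z.1 z.2 ^+ k) <= 1.
Proof.
have s01 (z : X * X) : 0 <= sqdot z.1 z.2 ^+ k <= 1.
  by rewrite exprn_ge0 ?sqdot_ge0// exprn_ile1 ?sqdot_ge0// sqdot_le1.
apply/andP; split.
  by apply: mean_ge0 => x; apply: mean_ge0 => y; have /andP[] := s01 (x, y).
have <- : double_mean mu nu (fun=> 1) = 1.
  by rewrite /double_mean mean_cst mean_cst.
apply: double_mean_le => [| |z]; [exact: bm_sqdotX|exact: bm_cst|].
by have /andP[] := s01 z.
Qed.

Section isotropic.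
Variables (sigma : probability X R) (c : nat -> R).
Hypothesis sigmac : forall k x, mean sigma (fun y => sqdot x y ^+ k) = c k.

Lemma isotropic_minimizer : energy_minimizer (@kernelB R n) sigma.
Proof.
have bB : bounded_measurable (fun z : X * X => kernelB z.1 z.2) by exact: bm_expsq.
move=> nu; rewrite !energyE// lee_fin -subr_ge0.
apply: le_trans (double_mean_expsq sigmac nu 0).
rewrite mulr_ge0 ?divr_ge0 ?expR_ge0// subr_ge0.
exact: moment_discrepancy_ge0.
Qed.

(** Zero excess energy forces every moment discrepancy to vanish, by [double_mean_expsq]. *)
Lemma minimizer_isotropic nu : energy_minimizer (@kernelB R n) nu ->
  same_measure nu sigma.
Proof.
have bB : bounded_measurable (fun z : X * X => kernelB z.1 z.2) by exact: bm_expsq.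
move=> /(_ sigma); rewrite !energyE// lee_fin => nusigma.
apply: (isotropic_unique sigmac) => k; apply/eqP; rewrite eq_le.
rewrite (moment_discrepancy_ge0 sigmac) andbT -subr_le0.
rewrite -(@pmulr_rle0 _ (expR (-1) / k`!%:R)); last first.
  by rewrite divr_gt0 ?expR_gt0// ltr0n fact_gt0.
apply: le_trans (double_mean_expsq sigmac nu k) _.
by rewrite subr_le0.
Qed.

(** Compare [mu] with [sigma]: the subtracted part of the energy lies between 0 and 2/q for both, so
    the excess energy for [kernelB] is at most 2/q. *)
Lemma kernelBq_minimizer_moment q mu k : (0 < q)%N -> ~~ odd q ->
  energy_minimizer (@kernelBq R n q) mu ->
  expR (-1) / k`!%:R * (double_mean mu mu (fun z => sqdot z.1 z.2 ^+ k) - c k) <=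
  q./2%:R^-1.
Proof.
move=> q0 oq /(_ sigma); rewrite !energyE; [|exact: bm_kernelBq..].
rewrite lee_fin !double_mean_kernelBq// => le1.
apply: le_trans (double_mean_expsq sigmac mu k) _.
have /andP[e0 e1] := double_mean_sqdotX01 mu mu q./2.
have /andP[s0 s1] := double_mean_sqdotX01 sigma sigma q./2.
have t0 : 0 <= q./2%:R^-1 :> R by rewrite invr_ge0.
move: le1 e0 e1 s0 s1 t0; set t := _^-1; nra.
Qed.

Section sequence.
Variable mu_ : nat -> probability X R.
Hypothesis mu_min : forall q : nat, (6 <= q)%N -> ~~ odd q ->
  energy_minimizer (@kernelBq R n q) (mu_ q).

Lemma kernelBq_moment_cvg k :
  double_mean (mu_ j.*2) (mu_ j.*2) (fun z => sqdot z.1 z.2 ^+ k) @[j --> \oo] --> c k.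
Proof.
pose a : R := expR (-1) / k`!%:R.
have a0 : 0 < a by rewrite divr_gt0 ?expR_gt0// ltr0n fact_gt0.
apply/cvgrPdist_lt => e e0; near=> j.
have j3 : (3 <= j)%N by near: j; exact: nbhs_infty_ge.
have j0 : 0 < j%:R :> R by rewrite ltr0n (leq_trans _ j3).
have je : (a * e)^-1 < j%:R by near: j; exact: nbhs_infty_gtr.
have minj : energy_minimizer (@kernelBq R n j.*2) (mu_ j.*2).
  by apply: mu_min; rewrite ?odd_double// -[6%N]/(3.*2) leq_double.
have := @kernelBq_minimizer_moment j.*2 _ k _ _ minj.
rewrite odd_double double_gt0 (leq_trans _ j3)// => /(_ isT isT).
rewrite doubleK -/a distrC => le1.
rewrite ger0_norm ?subr_ge0 ?(moment_discrepancy_ge0 sigmac)//.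
rewrite -(ltr_pM2l a0); apply: le_lt_trans le1 _.
by rewrite -[ltRHS]invrK ltf_pV2 ?posrE ?invr_gt0 ?mulr_gt0.
Unshelve. all: by end_near. Qed.

Lemma kernelBq_minimizers_weakly_converge :
  weakly_converges (fun k => mu_ k.*2) sigma.
Proof.
by apply: (weakly_converges_isotropic sigmac) => k; exact: kernelBq_moment_cvg.
Qed.

Lemma kernelBq_minimizer_finite_support q mu : (6 <= q)%N -> ~~ odd q ->
  energy_minimizer (@kernelBq R n q) mu -> finite_set (msupport mu).
Proof.
move=> q6 oq; apply: (@minimizer_finite_support R n q./2).
  exact: half_leq q6.
by move=> x y; exact: kernelBqE.
Qed.

Lemma kernelBq_minimizers_card : (0 < n)%N ->
  #|` fset_set (msupport (mu_ k.*2))| @[k --> \oo] --> \oo.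
Proof.
move=> n0; apply/cvgnyPge => M.
(* Fewer than [M] support points would keep the k-th energy above [1 / T], but its limit [c k] is
   below [e], half of that. Using [M.+1] keeps [T] positive. *)
pose T : R := 2 * M.+1%:R ^+ 2.
have T0 : 0 < T by rewrite mulr_gt0// exprn_gt0.
pose e : R := (2 * T)^-1.
have e0 : 0 < e by rewrite invr_gt0 mulr_gt0.
have [k cke] := isotropic_moment_small n0 sigmac e0.
have /cvgrPdist_lt/(_ _ e0) near_c := kernelBq_moment_cvg (k := k).
near=> j; rewrite leqNgt; apply/negP => cardM.
have j3 : (3 <= j)%N by near: j; exact: nbhs_infty_ge.
have j6 : (6 <= j.*2)%N by rewrite -[6%N]/(3.*2) leq_double.
have oj : ~~ odd j.*2 by rewrite odd_double.
have fin := kernelBq_minimizer_finite_support j6 oj (mu_min j6 oj).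
have := finite_support_moment_lb k fin (leq_trans (ltnW cardM) (leqnSn M)).
have : `|c k - double_mean (mu_ j.*2) (mu_ j.*2) (fun z => sqdot z.1 z.2 ^+ k)| < e.
  by near: j; exact: near_c.
rewrite ltr_distlC => /andP[_]; set E := double_mean _ _ _ => Ee.
have Ee2 : E < 2 * e by lra.
have e2 : T * (2 * e) = 1 by rewrite mulrCA mulrA mulfV// mulf_neq0// gt_eqF.
by rewrite -/T leNgt => /negP; apply; rewrite -e2 ltr_pM2l.
Unshelve. all: by end_near. Qed.

End sequence.
End isotropic.
End minimizers_of_kernelBq.

Theorem proposition6p3 (R : realType) (d : nat) (hd : (2 <= d)%N) :
  exists sigma : probability (RP R d.-1) R,
    [/\ unique_probability (@rotation_invariant R d.-1) sigma,
        unique_probability (energy_minimizer (@kernelB R d.-1)) sigma,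
        nonatomic sigma,
        forall q : nat, (6 <= q)%N -> ~~ odd q ->
          forall mu : probability (RP R d.-1) R,
            energy_minimizer (@kernelBq R d.-1 q) mu ->
            finite_set (msupport mu)
      & forall mu_ : nat -> probability (RP R d.-1) R,
          (forall q : nat, (6 <= q)%N -> ~~ odd q ->
            energy_minimizer (@kernelBq R d.-1 q) (mu_ q)) ->
          weakly_converges (fun k => mu_ k.*2) sigma /\
          #|` fset_set (msupport (mu_ k.*2))| @[k --> \oo] --> \oo].
Proof.
(* [RP R n] consists of lines in dimension n + 1, so d at least 2 means infinitely many lines, which
   makes the moments small. *)
have n0 : (0 < d.-1)%N by case: d hd => [|[|]].
have [sigma [c sigmac]] := isotropic_exists R d.-1.
exists sigma; split.
- split; first exact: isotropic_rotation_invariant sigmac.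
  by move=> nu; exact: rotation_invariant_unique sigmac nu.
- split; first exact: isotropic_minimizer sigmac.
  by move=> nu; exact: minimizer_isotropic sigmac nu.
- exact (isotropic_nonatomic n0 sigmac).
- by move=> q q6 oq mu; exact: kernelBq_minimizer_finite_support q6 oq.
move=> mu_ mu_min; split.
  exact (kernelBq_minimizers_weakly_converge sigmac mu_min).
exact (kernelBq_minimizers_card sigmac mu_min n0).
Qed.
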